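(* Let $\hat p,p_\circ\in[0,1]$, and assume $B_\bullet,B_\circ>0$. Then the function $\nu=\nu_{\hat p,p_\circ,\hat{\mathbf r},\mathbf a}$ on $\mathcal D_0$ defined, for $D=(v_\circ,\mathcal V,\mathcal E,\psi,\kappa)$, by $$\nu(D):=\hat p^{\,n_\ast(D)}(1-\hat p)^{n_\diamond(D)}\prod_{i\in\psi(V)\setminus\psi(V_\ast)}\hat{\mathbf r}_{\tau(i)}(\kappa(i))\ \prod_{\star\in\{\circ,\bullet\}}\prod_{s=1}^\sigma\prod_{(i,ij)\in\psi(\vec E^\star_s)}\mathbf a^\star_{s,\kappa(i)}(j)\ \times B_\circ^{-n_\circ(D)}B_\bullet^{-n_\bullet(D)}p_\circ^{\,n_\circ(D)}(1-p_\circ)^{n_\bullet(D)}$$ (with $0^0:=1$) is a subprobability measure on $\mathcal D_0$, i.e. $\sum_{D\in\mathcal D_0}\nu(D)\le1$.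
   Context: $\Lambda$: countable group, unit $0$, product $(i,j)\mapsto ij$; $h:\Lambda\to\mathbb Z$ a group homomorphism. Fix $\sigma\ge2$, $m\ge1$, nonempty finite $A_{s,k}\subset\{i:h(i)=1\}$ ($1\le s\le\sigma$, $1\le k\le m$), $\Delta_k:=\bigcup_sA_{s,k}$ (convention $A_{s,0}=\Delta_0=\emptyset$). Fix subprobability distributions $\mathbf a^\bullet_{s,k}$ on $A_{s,k}$ and $\mathbf a^\circ_{s,k}$ on $\Delta_k$, probability distributions $\hat{\mathbf r}_t$ on $\{1,\dots,m\}$ ($t\in\{\circ,1,\dots,\sigma\}$), and $B_\star:=\sum_{j\in\Lambda}\sup_k\mathbf a^\star_{\sigma,k}(j)$. Toom graph, rooted Toom graph, embedding, Toom contour: a Toom graph with $\sigma$ charges is a typed directed graph (vertex set $V$, types $\{\circ,\ast,1,\dots,\sigma\}$, edge types $\{1,\dots,\sigma\}$, every vertex typed) with: $v\in V_\circ$ has no incoming edges and equally many ($\le1$) outgoing edges of each charge; $v\in V_\ast$ has no outgoing edges and equally many ($\le1$) incoming edges of each charge; $v\in V_s$ has exactly one incoming and one outgoing edge of charge $s$ and none of other charges. Root $v_\circ\in V_\circ$; $V'_\circ:=V_\circ\setminus\{v_\circ\}$, $V'_s:=V_s\cup\{v_\circ\}$. Embedding $\psi:V\to\Lambda$: sinks' images differ from all other vertices' images, and $\psi$ is injective on each $V'_s$. Toom contour: $(v_\circ,\mathcal V,\mathcal E,\psi)$ with the Toom graph connected. $\vec E^\bullet_s:=\{(v,w)\in\vec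 E_s:v\in V'_s\}$, $\vec E^\circ_s:=\{(v,w)\in\vec E_s:v\in V'_\circ\}$, $\vec E^\circ=\bigcup_s\vec E^\circ_s$. Decorated Toom contour: additionally $\kappa:\psi(V)\to\{0,\dots,m\}$ with $\kappa=0$ on $\psi(V_\ast)$, $j\in A_{s,\kappa(i)}$ whenever $(i,ij)\in\psi(\vec E^\bullet_s)$, and $j\in\Delta_{\kappa(i)}$ whenever $(i,ij)\in\psi(\vec E^\circ)$. Two decorated contours are isomorphic if there is a bijection $\chi$ of vertex sets mapping root, typed vertices and typed edges onto each other with $\psi=\psi'\circ\chi$ and the same $\kappa$. $\mathcal D_0$ is the set of isomorphism classes of decorated Toom contours with $\psi(v_\circ)=0$. $n_\ast(D)=|V_\ast|$, $n_\diamond(D)=|\psi(V)\setminus\psi(V_\ast)|$, $n_\circ(D)=|\vec E^\circ_s|$, $n_\bullet(D)=|\vec E^\bullet_s|$ (these do not depend on $s$). Natural order: an incomplete Toom graph, its loose ends, its most urgent loose end, extensions, and the trivial (incomplete) Toom graph are defined as follows. Incomplete Toom graph: connected typed directed graph with vertex set $\{0,\dots,N\}$, $0\in V_\circ$, where sources have no incoming edges and at most one outgoing edge per charge, sinks have no outgoing edges and at most one incoming per charge, $v\in V_s$ has at most one incoming and one outgoing charge-$s$ edge and no other edges, and either it is the trivial Toom graph ($V_\circ=V_\ast=\{0\}$, no edges) or: each $v\in(V_\sigma\cup V_\circ)\setminus\{0\}$ has an outgoing charge-$\sigma$ edge, each $v\in V_s$ ($s<\sigma$) has an incoming charge-$s$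 edge, each sink has an incoming edge of some charge $s<\sigma$. Trivial incomplete Toom graph: $V=V_\circ=\{0\}$, $V_\ast=\emptyset$, no edges. Loose end: $(v,s)$ with $v\in V_\circ\cup V_s$, $s<\sigma$, no outgoing charge-$s$ edge; or $v\in V_\ast\cup V_\sigma$, $s=\sigma$, no incoming charge-$\sigma$ edge. Most urgent: smallest $s$, then smallest $v$. Extension at $(v,s)$: an incomplete Toom graph containing the old one with exactly one extra edge, $(v,w,s)$ if $s<\sigma$ or $(w,v,\sigma)$ if $s=\sigma$. For a nontrivial rooted connected Toom graph there is a unique bijection $\eta:V\to\{0,\dots,|V|-1\}$ with $\eta(v_\circ)=0$ such that the graph relabelled by $\eta$ is obtained from the trivial incomplete Toom graph by successive extensions at the most urgent loose end; the natural order is $v\le w\iff\eta(v)\le\eta(w)$ (for the trivial Toom graph it is the order on a single vertex). Type function: $\tau'(v_\circ):=1$, and for $v\ne v_\circ$, $\tau'(v):=\circ$ if $v\in V'_\circ$, $\ast$ if $v\in V_\ast$, $s$ if $v\in V_s$; for $i\in\psi(V)$, $\tau(i):=\tau'(f(i))$ with $f(i)$ the smallest (in the natural order) $v$ with $\psi(v)=i$.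
   Formalization: A source without outgoing edges is required to be also a sink, so the single vertex with V_∘={v}, V_*=∅ is not a Toom graph; otherwise the two one-vertex contours alone already have total weight 1 and the sum can exceed 1. *)

(* Defs.v *)
From HB Require Import structures.
From mathcomp Require Import all_boot all_order all_algebra.
Unset Strict Implicit. Unset Printing Implicit Defensive.
Import Order.TTheory GRing.Theory Num.Theory.

Inductive vtype := Src | Snk | Chg of nat.

Definition valid_type (sigma : nat) (t : vtype) : bool :=
  match t with Src | Snk => true | Chg s => (1 <= s <= sigma)%N end.

(* Typed directed graphs on the vertex set {0,...,nv-1}.               *)
(* tv v t : v belongs to V_t ; edges (v,w,s) : directed edge v->w of   *)
(* charge s.                                                           *)
Record tgraph := TG { nv : nat; tv : nat -> vtype -> bool;
                      te : seq (nat * nat * nat) }.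

Definition outdeg (G : tgraph) (v s : nat) : nat :=
  count (fun e : nat * nat * nat => (e.1.1 == v) && (e.2 == s)) (te G).
Definition indeg (G : tgraph) (v s : nat) : nat :=
  count (fun e : nat * nat * nat => (e.1.2 == v) && (e.2 == s)) (te G).

Definition tadj (G : tgraph) : rel 'I_(nv G) := fun u v =>
  has (fun e : nat * nat * nat =>
         ((e.1.1 == u) && (e.1.2 == v)) || ((e.1.1 == v) && (e.1.2 == u))) (te G).

Definition tconnected (G : tgraph) : Prop :=
  forall u v : 'I_(nv G), connect (@tadj G) u v.

Definition twf (sigma : nat) (G : tgraph) : Prop :=
  uniq (te G) /\
  (forall e, e \in te G -> [/\ e.1.1 < nv G, e.1.2 < nv G & 1 <= e.2 <= sigma]%N) /\
  (forall v, v < nv G -> exists t, valid_type sigma t /\ tv G v t)%N /\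
  (forall v s, v < nv G -> tv G v (Chg s) -> 1 <= s <= sigma)%N.

Definition toom_graph (sigma : nat) (G : tgraph) : Prop :=
  twf sigma G /\
  forall v, (v < nv G)%N ->
   [/\ tv G v Src ->
         (forall s, indeg G v s = 0%N) /\
         (exists d, (d <= 1)%N /\ forall s, (1 <= s <= sigma)%N -> outdeg G v s = d),
       (* convention: a source without outgoing edges (i.e. the single vertex
          of the trivial Toom graph) is also a sink: V_o = V_* = {0} *)
       tv G v Src -> (forall s, outdeg G v s = 0%N) -> tv G v Snk,
       tv G v Snk ->
         (forall s, outdeg G v s = 0%N) /\
         (exists d, (d <= 1)%N /\ forall s, (1 <= s <= sigma)%N -> indeg G v s = d)
     & forall s, tv G v (Chg s) ->
         [/\ indeg G v s = 1%N, outdeg G v s = 1%N &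
             forall s', s' != s -> indeg G v s' = 0%N /\ outdeg G v s' = 0%N]].

Definition trivial_toom (G : tgraph) : Prop :=
  [/\ nv G = 1%N, tv G 0 Src, tv G 0 Snk, te G = [::] &
      forall s, ~~ tv G 0 (Chg s)].

Definition incomplete_toom (sigma : nat) (G : tgraph) : Prop :=
  [/\ (0 < nv G)%N /\ tv G 0 Src, twf sigma G, tconnected G,
      (forall v, (v < nv G)%N ->
       [/\ tv G v Src -> (forall s, indeg G v s = 0%N) /\ (forall s, outdeg G v s <= 1)%N,
           tv G v Snk -> (forall s, outdeg G v s = 0%N) /\ (forall s, indeg G v s <= 1)%N
         & forall s, tv G v (Chg s) ->
             [/\ (indeg G v s <= 1)%N, (outdeg G v s <= 1)%N &
                 forall s', s' != s -> indeg G v s' = 0%N /\ outdeg G v s' = 0%N]])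
    & trivial_toom G \/
      forall v, (v < nv G)%N ->
       [/\ (tv G v (Chg sigma) || tv G v Src) -> v != 0%N -> (0 < outdeg G v sigma)%N,
           forall s, (s < sigma)%N -> tv G v (Chg s) -> (0 < indeg G v s)%N
         & tv G v Snk -> exists2 s, (s < sigma)%N & (0 < indeg G v s)%N]].

Definition triv_incomplete : tgraph :=
  TG 1 (fun v t => (v == 0%N) && (if t is Src then true else false)) [::].

Definition loose_end (sigma : nat) (G : tgraph) (v s : nat) : bool :=
  (v < nv G)%N &&
  ([&& 1 <= s, s < sigma, tv G v Src || tv G v (Chg s) & outdeg G v s == 0]%N
   || [&& s == sigma, tv G v Snk || tv G v (Chg sigma) & indeg G v sigma == 0]%N).

Definition most_urgent (sigma : nat) (G : tgraph) (v s : nat) : Prop :=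
  loose_end sigma G v s /\
  forall v' s', loose_end sigma G v' s' -> (s < s')%N \/ (s = s' /\ (v <= v')%N).

Definition extension (sigma : nat) (G G2 : tgraph) (v s : nat) : Prop :=
  [/\ incomplete_toom sigma G2, (nv G <= nv G2)%N,
      (forall u t, (u < nv G)%N -> tv G u t -> tv G2 u t) &
      exists w, let e := if (s < sigma)%N then (v, w, s) else (w, v, sigma) in
        e \notin te G /\ te G2 =i e :: te G].

Definition tg_eq (G H : tgraph) : Prop :=
  [/\ nv G = nv H, (forall v t, (v < nv G)%N -> tv G v t = tv H v t) & te G =i te H].

Definition obtained_by_extensions (sigma : nat) (G : tgraph) : Prop :=
  exists (M : nat) (Gs : nat -> tgraph),
    [/\ tg_eq (Gs 0%N) triv_incomplete, tg_eq (Gs M) G &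
        forall k, (k < M)%N -> exists v s,
          most_urgent sigma (Gs k) v s /\ extension sigma (Gs k) (Gs k.+1) v s].

Record dcontour (L : Type) := DC {
  dN : nat;
  droot : 'I_dN;
  dtv : 'I_dN -> vtype -> bool;
  dte : seq ('I_dN * 'I_dN * nat);
  dpsi : 'I_dN -> L;
  dkappa : L -> nat }.
Arguments dN {L} d.
Arguments droot {L} d.
Arguments dtv {L} d _ _.
Arguments dte {L} d.
Arguments dpsi {L} d _.
Arguments dkappa {L} d _.

Definition relabel {L : Type} (D : dcontour L) (eta : 'I_(dN D) -> nat) : tgraph :=
  TG (dN D) (fun k t => [exists v, (eta v == k) && dtv D v t])
     [seq (eta e.1.1, eta e.1.2, e.2) | e <- dte D].

Definition underlying {L : Type} (D : dcontour L) : tgraph :=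
  relabel D (fun v => nat_of_ord v).

(* A_{s,k} with the convention A_{s,0} = empty, Delta_k = U_s A_{s,k} *)
Definition inA {L : eqType} (A : nat -> nat -> seq L) (s k : nat) (j : L) : bool :=
  (1 <= k)%N && (j \in A s k).
Definition Delta_list {L : eqType} (sigma : nat) (A : nat -> nat -> seq L) (k : nat) : seq L :=
  flatten [seq A s k | s <- iota 1 sigma].
Definition inDelta {L : eqType} (sigma : nat) (A : nat -> nat -> seq L) (k : nat) (j : L) : bool :=
  (1 <= k)%N && (j \in Delta_list sigma A k).

(* (isomorphism class of a) decorated Toom contour with psi(root) = unit,
   i.e. an element of D_0 *)
Definition in_D0 {L : countType} (mul : L -> L -> L) (inv : L -> L) (unit : L)
  (sigma m : nat) (A : nat -> nat -> seq L) (D : dcontour L) : Prop :=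
  let G := underlying D in
  let psi := dpsi D in let kap := dkappa D in
  [/\ toom_graph sigma G /\ dtv D (droot D) Src, tconnected G,
      (forall v w, dtv D v Snk -> v != w -> psi v != psi w) /\
      (forall s v w, (1 <= s <= sigma)%N ->
          (dtv D v (Chg s) || (v == droot D)) -> (dtv D w (Chg s) || (w == droot D)) ->
          psi v = psi w -> v = w),
      psi (droot D) = unit &
      [/\ forall v, (kap (psi v) <= m)%N,
          forall v, dtv D v Snk -> kap (psi v) = 0%N &
          forall e, e \in dte D ->
            let v := e.1.1 in let i := psi v in let j := mul (inv i) (psi e.1.2) in
            ((dtv D v (Chg e.2) || (v == droot D)) -> inA A e.2 (kap i) j) /\
            ((dtv D v Src && (v != droot D)) -> inDelta sigma A (kap i) j)]].

Definition dc_iso {L : Type} (D D' : dcontour L) : Prop :=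
  exists chi : 'I_(dN D) -> 'I_(dN D'),
    [/\ bijective chi /\ chi (droot D) = droot D',
        (forall v t, dtv D v t = dtv D' (chi v) t),
        (forall v w s, ((v, w, s) \in dte D) = ((chi v, chi w, s) \in dte D')),
        (forall v, dpsi D v = dpsi D' (chi v)) &
        forall v, dkappa D (dpsi D v) = dkappa D' (dpsi D v)].

Definition natural_labelling {L : Type} (sigma : nat) (D : dcontour L)
  (eta : 'I_(dN D) -> 'I_(dN D)) : Prop :=
  [/\ injective eta, nat_of_ord (eta (droot D)) = 0%N &
      dN D = 1%N \/ obtained_by_extensions sigma (relabel D (fun v => nat_of_ord (eta v)))].

Definition tau' {L : Type} (sigma : nat) (D : dcontour L) (v : 'I_(dN D)) : vtype :=
  if v == droot D then Chg 1
  else if dtv D v Src then Src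
  else if dtv D v Snk then Snk
  else Chg (nth 0%N [seq s <- iota 1 sigma | dtv D v (Chg s)] 0%N).

Definition tau {L : eqType} (sigma : nat) (D : dcontour L)
  (eta : 'I_(dN D) -> 'I_(dN D)) (i : L) : vtype :=
  match [pick v | (dpsi D v == i) &&
                  [forall w, (dpsi D w == i) ==> (nat_of_ord (eta v) <= eta w)%N]] with
  | Some v => tau' sigma D v
  | None => Src
  end.

Section Nu.
Context {R : realFieldType}.
Local Open Scope ring_scope.

(* B_* = sum_{j in Lambda} sup_k a^*_{sigma,k}(j); the sum is restricted to the
   (finite) union of the supports, outside of which all terms vanish. *)
Definition Bbul {L : eqType} (sigma m : nat) (A : nat -> nat -> seq L)
  (abul : nat -> nat -> L -> R) : R :=
  \sum_(j <- undup (flatten [seq A sigma k | k <- iota 1 m]))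
     \big[Num.max/0]_(k <- iota 1 m) abul sigma k j.

Definition Bcir {L : eqType} (sigma m : nat) (A : nat -> nat -> seq L)
  (acir : nat -> nat -> L -> R) : R :=
  \sum_(j <- undup (flatten [seq Delta_list sigma A k | k <- iota 1 m]))
     \big[Num.max/0]_(k <- iota 1 m) acir sigma k j.

Definition nu {L : countType} (mul : L -> L -> L) (inv : L -> L)
  (sigma m : nat) (A : nat -> nat -> seq L)
  (abul acir : nat -> nat -> L -> R) (rhat : vtype -> nat -> R) (phat pcir : R)
  (D : dcontour L) (eta : 'I_(dN D) -> 'I_(dN D)) : R :=
  let psi := dpsi D in let kap := dkappa D in
  let nstar := #|[pred v | dtv D v Snk]| in
  let imgS := [seq psi v | v <- enum 'I_(dN D) & dtv D v Snk] in
  let imgNS := undup [seq psi v | v <- enum 'I_(dN D) & psi v \notin imgS] in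
  let Ebul s := [seq e <- dte D | (e.2 == s) && (dtv D e.1.1 (Chg s) || (e.1.1 == droot D))] in
  let Ecir s := [seq e <- dte D | (e.2 == s) && (dtv D e.1.1 Src && (e.1.1 != droot D))] in
  let pairs E := undup [seq (psi e.1.1, psi e.1.2) | e <- E] in
  let prodE (a : nat -> nat -> L -> R) E s :=
      \prod_(p <- pairs E) a s (kap p.1) (mul (inv p.1) p.2) in
  let nbul := size (Ebul 1%N) in
  let ncir := size (Ecir 1%N) in
  phat ^+ nstar * (1 - phat) ^+ size imgNS
  * \prod_(i <- imgNS) rhat (tau sigma D eta i) (kap i)
  * \prod_(1 <= s < sigma.+1) (prodE acir (Ecir s) s * prodE abul (Ebul s) s)
  * (Bcir sigma m A acir)^-1 ^+ ncir * (Bbul sigma m A abul)^-1 ^+ nbul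
  * pcir ^+ ncir * (1 - pcir) ^+ nbul.

End Nu.

(* Main.v *)
(* A decorated contour is encoded by the word of choices that an exploration
   makes while building it along the natural order, one word of symbols
   (star, j, k) per contour.  At the most urgent loose end (v, s) the symbol
   gives the jump j along the new edge, the decoration k of the site reached
   (if that site is new), and, for s = sigma, whether the new edge starts at a
   source other than the root.  For s < sigma the starting point of the edge is
   known and j follows the law a_{s,kappa}; for s = sigma only the end point is
   known, so that kappa is not available yet and j follows the normalised
   supremum of the laws, which costs the factors B.  The words of pairwise
   non-isomorphic contours are prefix-free, so the Kraft inequality bounds the
   sum of their weights by 1, and nu D is at most the weight of the word of D.
   Since nu counts the edges of charge 1 while the exploration pays p and B on
   those of charge sigma, one also needs that the numbers of edges do not depend
   on the charge: h grows by 1 along each edge, so the number of edges of charge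
   s is the sum of h over the sinks minus that over the sources. *)
Require Import Defs.
From HB Require Import structures.
From mathcomp Require Import all_boot all_order all_algebra.
Import Order.TTheory GRing.Theory Num.Theory.
Local Open Scope ring_scope.
Set Implicit Arguments.
Unset Strict Implicit.
Unset Printing Implicit Defensive.

Definition nat_of_vtype (t : vtype) : nat :=
  match t with Src => 0 | Snk => 1 | Chg s => s.+2 end.
Definition vtype_of_nat (k : nat) : vtype :=
  match k with 0 => Src | 1 => Snk | s.+2 => Chg s end.
Lemma nat_of_vtypeK : cancel nat_of_vtype vtype_of_nat.
Proof. by case. Qed.
HB.instance Definition _ := Equality.copy vtype (can_type nat_of_vtypeK).

(** * Subprobability kernels and the Kraft inequality *)

Lemma sum_fibers (R : nmodType) (I J : eqType) (p : I -> J) (s : seq I) (F : I -> R) :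
  \sum_(z <- s) F z = \sum_(x <- undup (map p s)) \sum_(z <- s | p z == x) F z.
Proof.
rewrite (exchange_big_dep xpredT) //=; apply: eq_big_seq => z zs.
rewrite -big_filter (_ : [seq x <- _ | _] = [:: p z]) ?big_seq1 //.
rewrite (eq_filter (a2 := pred1 (p z))) => [|x /=]; last exact: eq_sym.
by rewrite filter_pred1_uniq ?undup_uniq ?mem_undup ?map_f.
Qed.

Section Kraft.
Context {R : realFieldType}.

(** Mass is measured on finite duplicate-free lists, so that no infinite sum over [X] has to be
    defined. *)
Definition subdist {X : eqType} (f : X -> R) : Prop :=
  (forall x, 0 <= f x) /\ forall s, uniq s -> \sum_(x <- s) f x <= 1.

(** Draw [x], then [y] from a law that may depend on [x]: grouping the pairs by [x] leaves a
    conditional mass of at most 1 in each group. *)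
Lemma subdist_prod (X Y : eqType) (f : X -> R) (g : X -> Y -> R) :
  subdist f -> (forall x, subdist (g x)) ->
  subdist (fun z : X * Y => f z.1 * g z.1 z.2).
Proof.
move=> [f0 f1] Hg; split=> [z|s us]; first by rewrite mulr_ge0 ?(proj1 (Hg _)).
rewrite (sum_fibers fst).
apply: le_trans (f1 _ (undup_uniq (map fst s))); apply: ler_sum => x _.
rewrite (eq_bigr (fun z : X * Y => f x * g x z.2)); last by move=> z /eqP->.
rewrite -big_distrr /= -[leRHS]mulr1 ler_wpM2l //.
rewrite -big_filter -[leLHS](big_map snd xpredT (g x)).
apply: (proj2 (Hg x)); rewrite map_inj_in_uniq ?filter_uniq //.
by move=> [a b] [c d]; rewrite !mem_filter /= => /andP[/eqP-> _] /andP[/eqP-> _] ->.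
Qed.

Lemma subdist_delta (X : eqType) (a : X) : subdist (fun x => (x == a)%:R : R).
Proof.
split=> [x|s us]; first exact: ler0n.
rewrite -natr_sum -[leRHS]/(1%:R) ler_nat.
by rewrite -big_mkcond sum1_count count_uniq_mem // leq_b1.
Qed.

Lemma subdist_zero (X : eqType) : subdist (fun x : X => 0 : R).
Proof. by split=> // s _; rewrite big1 // ler01. Qed.

Lemma subdist_supp (X : eqType) (f : X -> R) (t : seq X) :
  (forall x, 0 <= f x) -> (forall x, x \notin t -> f x = 0) ->
  \sum_(x <- undup t) f x <= 1 -> subdist f.
Proof.
move=> f0 ft f1; split=> // s us; apply: le_trans f1.
rewrite (bigID (mem t)) /= addrC big1 ?add0r // -big_filter.
rewrite (perm_big [seq x <- undup t | x \in s]); last first.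
  apply: uniq_perm; rewrite ?filter_uniq ?undup_uniq // => x.
  by rewrite !mem_filter mem_undup andbC.
by rewrite [leRHS](bigID (mem s)) /= big_filter lerDl sumr_ge0.
Qed.

Section Process.
Variables (X : eqType) (S : Type) (step : S -> X -> S) (q : S -> X -> R).
Hypothesis q_subdist : forall st, subdist (q st).

(** The chance that a process emitting letters by [q], with deterministic update [step], starts by
    emitting [w]. *)
Fixpoint weight (st : S) (w : seq X) : R :=
  if w is x :: w' then q st x * weight (step st x) w' else 1.

Lemma weight_rcons st w x :
  weight st (rcons w x) = weight st w * q (foldl step st w) x.
Proof. by elim: w st => /= [|y w IH] st; rewrite ?mulr1 ?mul1r // IH mulrA. Qed.

(** By induction on the length. The empty word is a prefix of every word, so it can only occur
    alone; otherwise the words are grouped by first letter, and the tails of each group are again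
    prefix-free. *)
Lemma kraft st (ws : seq (seq X)) :
  uniq ws -> {in ws &, forall u v, prefix u v -> u = v} ->
  \sum_(w <- ws) weight st w <= 1.
Proof.
(* The length bound is strict, so that in the base case there is no word at all. *)
have : all (fun w => size w < (\max_(w <- ws) size w).+1)%N ws.
  by apply/allP => w ww; rewrite ltnS; apply: leq_bigmax_seq.
move: _.+1 => n; elim: n st ws => [|n IH] st ws szn uw pw.
  by case: ws szn {uw pw} => // _; rewrite big_nil ler01.
have [nilw|nilw] := boolP ([::] \in ws).
  suff -> : ws = [:: [::]] by rewrite big_seq1.
  have all0 w : w \in ws -> w = [::] by move=> ww; rewrite -(pw _ _ nilw ww) // prefix0s.
  case: ws nilw uw all0 {szn pw} => // a [|b ws] _ uw all0.
    by rewrite (all0 a) ?mem_head.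
  by move: uw; rewrite (all0 a) ?mem_head // (all0 b) ?inE ?eqxx ?orbT.
(* The head [None] cannot occur here, since the empty word is absent. *)
rewrite (sum_fibers ohead).
pose qo o := if o is Some x then q st x else 0.
apply: (@le_trans _ _ (\sum_(o <- undup (map ohead ws)) qo o)); last first.
  have -> : \sum_(o <- undup (map ohead ws)) qo o
      = \sum_(x <- pmap id (undup (map ohead ws))) q st x.
    by rewrite big_pmap; apply: eq_bigr => -[].
  by apply: (proj2 (q_subdist st)); apply: pmap_uniq (undup_uniq _) => -[].
rewrite big_seq [leRHS]big_seq; apply: ler_sum => o; rewrite mem_undup => /mapP[[|x w] ww ->] /=.
  by rewrite ww in nilw.
rewrite -big_filter.
have eqs : [seq z <- ws | ohead z == Some x]
    = map (cons x) (map behead [seq z <- ws | ohead z == Some x]).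
  rewrite -map_comp -[LHS]map_id; apply/eq_in_map => z.
  by rewrite mem_filter => /andP[]; case: z => //= y z /eqP[->].
rewrite eqs big_map /= -big_distrr /= -[leRHS]mulr1 ler_wpM2l ?(proj1 (q_subdist _)) //.
set ws' := map behead _ in eqs *.
have subw z : z \in ws' -> x :: z \in ws.
  move=> zw; suff : x :: z \in map (cons x) ws' by rewrite -eqs mem_filter => /andP[].
  exact: map_f.
have consI : injective (cons x) by move=> ? ? [].
apply: IH.
- by apply/allP => z /subw /(allP szn).
- by rewrite -(map_inj_uniq consI) -eqs filter_uniq.
- move=> u v /subw uu /subw vv puv; apply: consI; apply: pw => //.
  by rewrite /= eqxx.
Qed.
End Process.
End Kraft.


(** * The exploration: states, symbols and transitions *)

Section Exploration.
Context {L : countType} (mul : L -> L -> L) (inv : L -> L) (unit : L) (sigma : nat).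

(* A state lists the vertices as (type, position, decoration), a vertex being
   named by its rank, followed by the edges; it is empty before the root is
   decorated. *)
Definition state : Type := (seq (vtype * L * nat) * seq (nat * nat * nat))%type.
Definition symbol : Type := (bool * L * nat)%type.
Implicit Type st : state.

Definition vertex st v := nth (Src, unit, 0%N) st.1 v.
Definition vty st v := (vertex st v).1.1.
Definition vpos st v := (vertex st v).1.2.
Definition vkap st v := (vertex st v).2.
Definition positions st := [seq u.1.2 | u <- st.1].

(** One type per vertex: the vertex of the trivial contour, at once source and sink, is stored as
    [Src] with decoration 0. *)
Definition graph st : tgraph := TG (size st.1) (fun v t => t == vty st v) st.2.
Definition ends st := [seq (v, s) | s <- iota 1 sigma, v <- iota 0 (size st.1)].
Definition loose st (vs : nat * nat) := loose_end sigma (graph st) vs.1 vs.2.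
Definition urgentb st (vs : nat * nat) : bool :=
  loose st vs && all (fun vs' => loose st vs' ==>
    (vs.2 < vs'.2) || ((vs.2 == vs'.2) && (vs.1 <= vs'.1)))%N (ends st).
Definition urgent st := nth (0%N, 1%N) (ends st) (find (urgentb st) (ends st)).

(* A root decorated by 0 is a sink, which is the trivial contour. *)
Definition live st : bool := (size st.1 == 0%N) || (vkap st 0 != 0%N) && has (loose st) (ends st).

(** Below charge [sigma] the edge leaves the known vertex; at charge [sigma] it enters it, so the
    jump is undone. *)
Definition newpos st (vs : nat * nat) (j : L) : L :=
  mul (vpos st vs.1) (if (vs.2 < sigma)%N then j else inv j).
Definition newtype (s : nat) (b : bool) : vtype :=
  if (s < sigma)%N then Chg s else if b then Src else Chg sigma.

(* The new edge attaches to an already visited vertex only if that vertex is a sink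
   (s < sigma) or the root (s = sigma, not starred): in an incomplete Toom graph
   all others already have their edge of charge s on that side. *)
Definition step st (x : symbol) : state :=
  if size st.1 == 0%N then ([:: (Src, unit, x.2)], [::]) else
  let vs := urgent st in
  let p := newpos st vs x.1.2 in
  let k := if p \in positions st then vkap st (index p (positions st)) else x.2 in
  let old := (p \in positions st) &&
             (if (vs.2 < sigma)%N then k == 0%N else ~~ x.1.1 && (p == unit)) in
  let w := if old then index p (positions st) else size st.1 in
  let t := if (vs.2 < sigma)%N && (k == 0%N) then Snk else newtype vs.2 x.1.1 in
  (if old then st.1 else rcons st.1 (t, p, k),
   (if (vs.2 < sigma)%N then (vs.1, w, vs.2) else (w, vs.1, sigma)) :: st.2).

Lemma loose_ends st v s : (1 <= sigma)%N -> loose_end sigma (graph st) v s -> (v, s) \in ends st.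
Proof.
move=> s1 /andP[vn h]; apply/allpairsPdep; exists s, v; split=> //; rewrite mem_iota ?add0n //.
by case/orP: h => [/and4P[-> ss _ _]|/and3P[/eqP-> _ _]]; rewrite ?s1 /= add1n ltnS // ltnW.
Qed.

Lemma has_loose st : (1 <= sigma)%N ->
  reflect (exists v s, loose_end sigma (graph st) v s) (has (loose st) (ends st)).
Proof.
move=> s1; apply: (iffP hasP) => [[[v s] _ l]|[v [s l]]]; first by exists v, s.
by exists (v, s); rewrite ?loose_ends.
Qed.

(** This covers states without loose ends, where the default pair has charge 1, so that the kernel
    is a subdistribution at every state. *)
Lemma urgent_charge st : (1 <= sigma)%N -> (1 <= (urgent st).2 <= sigma)%N.
Proof.
move=> s1; rewrite /urgent; have [lt|ge] := ltnP (find (urgentb st) (ends st)) (size (ends st)).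
  have /allpairsPdep[s [v [+ _ ->]]] := mem_nth (0%N, 1%N) lt.
  by rewrite mem_iota add1n ltnS.
by rewrite nth_default.
Qed.

(** The lexicographic order on pairs is antisymmetric, so the most urgent loose end is unique and
    the search finds it. *)
Lemma most_urgent_urgent st v s : (1 <= sigma)%N ->
  most_urgent sigma (graph st) v s -> urgent st = (v, s).
Proof.
move=> s1 [lvs mvs]; have vsE := loose_ends s1 lvs.
have ub : urgentb st (v, s).
  rewrite /urgentb /loose /= lvs; apply/allP => -[v' s'] _; apply/implyP => /= /mvs[->//|[-> ->]].
  by rewrite eqxx orbT.
have hub : has (urgentb st) (ends st) by apply/hasP; exists (v, s).
have : urgentb st (urgent st) := nth_find (0%N, 1%N) hub.
case: (urgent st) => v' s' /andP[l /allP /(_ _ vsE)].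
rewrite /loose /= lvs /=; case: (mvs _ _ l) => [lt|[-> le]].
  by rewrite ltnNge (ltnW lt) /= => /andP[/eqP eqs _]; rewrite eqs ltnn in lt.
by rewrite ltnn eqxx /= => le'; congr (_, _); apply/eqP; rewrite eqn_leq le le'.
Qed.

(** * The transition kernel is a subprobability at every state *)

Section Weights.
Context {R : realFieldType} (m : nat) (A : nat -> nat -> seq L).
Variables (abul acir : nat -> nat -> L -> R) (rhat : vtype -> nat -> R) (phat pcir : R).

Definition maxw (a : nat -> nat -> L -> R) (j : L) : R :=
  \big[Num.max/0]_(k <- iota 1 m) a sigma k j.
(** Below charge [sigma] the star carries no choice and is forced to [false]. *)
Definition star_wt (s : nat) (b : bool) : R :=
  if (s < sigma)%N then (b == false)%:R else if b then pcir else 1 - pcir.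
(** The root has rank 0 and jumps by [abul] although it is a source. Decorations outside 1..m get
    weight 0, since nothing is assumed about the laws there. *)
Definition pos_wt st (vs : nat * nat) (b : bool) (j : L) : R :=
  if (vs.2 < sigma)%N then
    if (1 <= vkap st vs.1 <= m)%N then
      if (vty st vs.1 == Src) && (vs.1 != 0%N) then acir vs.2 (vkap st vs.1) j
      else abul vs.2 (vkap st vs.1) j
    else 0
  else if b then maxw acir j / Bcir sigma m A acir else maxw abul j / Bbul sigma m A abul.
(** Decoration 0 stands for a sink, whatever the proposed type [t]. *)
Definition vertex_wt (t : vtype) (k : nat) : R :=
  if k == 0%N then phat else if (k <= m)%N then (1 - phat) * rhat t k else 0.
(* On a visited site the decoration is known and the symbol carries a dummy 0. *)
Definition kap_wt st (p : L) (t : vtype) (k : nat) : R :=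
  if p \in positions st then (k == 0%N)%:R else vertex_wt t k.

(** The first symbol only decorates the root, by the law of type [Chg 1] because the type function
    is 1 at the root; its other entries are fixed dummies. *)
Definition kernel st (x : symbol) : R :=
  if size st.1 == 0%N then (x.1 == (false, unit))%:R * vertex_wt (Chg 1) x.2 else
  star_wt (urgent st).2 x.1.1 * pos_wt st (urgent st) x.1.1 x.1.2 *
  kap_wt st (newpos st (urgent st) x.1.2) (newtype (urgent st).2 x.1.1) x.2.

Hypothesis sigma_ge2 : (2 <= sigma)%N.
Hypothesis m_ge1 : (1 <= m)%N.
Hypothesis abul_ge0 : forall s k j, (1 <= s <= sigma)%N -> (1 <= k <= m)%N -> 0 <= abul s k j.
Hypothesis abul_supp : forall s k j, (1 <= s <= sigma)%N -> (1 <= k <= m)%N ->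
                 j \notin A s k -> abul s k j = 0.
Hypothesis abul_sub : forall s k, (1 <= s <= sigma)%N -> (1 <= k <= m)%N ->
                 \sum_(j <- undup (A s k)) abul s k j <= 1.
Hypothesis acir_ge0 : forall s k j, (1 <= s <= sigma)%N -> (1 <= k <= m)%N -> 0 <= acir s k j.
Hypothesis acir_supp : forall s k j, (1 <= s <= sigma)%N -> (1 <= k <= m)%N ->
                 j \notin Delta_list sigma A k -> acir s k j = 0.
Hypothesis acir_sub : forall s k, (1 <= s <= sigma)%N -> (1 <= k <= m)%N ->
                 \sum_(j <- undup (Delta_list sigma A k)) acir s k j <= 1.
Hypothesis rhat_ge0 : forall t k, (t = Src \/ exists2 s, (1 <= s <= sigma)%N & t = Chg s) ->
                0 <= rhat t k.
Hypothesis rhat_sum : forall t, (t = Src \/ exists2 s, (1 <= s <= sigma)%N & t = Chg s) ->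
                \sum_(1 <= k < m.+1) rhat t k = 1.
Hypothesis phat0 : 0 <= phat.
Hypothesis phat1 : phat <= 1.
Hypothesis pcir0 : 0 <= pcir.
Hypothesis pcir1 : pcir <= 1.
Hypothesis Bbul_pos : 0 < Bbul sigma m A abul.
Hypothesis Bcir_pos : 0 < Bcir sigma m A acir.

Lemma subdist_maxw (a : nat -> nat -> L -> R) (S : nat -> seq L) :
  (forall k j, (1 <= k <= m)%N -> 0 <= a sigma k j) ->
  (forall k j, (1 <= k <= m)%N -> j \notin S k -> a sigma k j = 0) ->
  let B := \sum_(j <- undup (flatten [seq S k | k <- iota 1 m])) maxw a j in
  0 < B -> subdist (fun j => maxw a j / B).
Proof.
move=> a0 aS B B0; apply: (@subdist_supp _ _ _ (flatten [seq S k | k <- iota 1 m])).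
- by move=> j; rewrite divr_ge0 ?(ltW B0) // bigmax_ge_id.
- move=> j jS; rewrite (_ : maxw a j = 0) ?mul0r //; apply/eqP.
  rewrite eq_le bigmax_ge_id andbT /maxw big_seq; apply: bigmax_le => // k ki.
  rewrite aS //; first by move: ki; rewrite mem_iota add1n ltnS.
  by apply: contra jS => jk; apply/flatten_mapP; exists k.
- by rewrite -big_distrl /= divff ?gt_eqF.
Qed.

Lemma maxw_ge a k j : (1 <= k <= m)%N -> a sigma k j <= maxw a j.
Proof. by move=> km; apply: le_bigmax_seq; rewrite // mem_iota add1n ltnS. Qed.

Lemma subdist_vertex t :
  (t = Src \/ exists2 s, (1 <= s <= sigma)%N & t = Chg s) -> subdist (vertex_wt t).
Proof.
move=> ht; have p1 : 0 <= 1 - phat by rewrite subr_ge0.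
apply: (@subdist_supp _ _ _ (iota 0 m.+1)).
- by move=> k; rewrite /vertex_wt; case: ifP => // _; case: ifP => // _; rewrite mulr_ge0 ?rhat_ge0.
- move=> k; rewrite mem_iota /= add0n ltnS /vertex_wt => km.
  by rewrite (negPf km); case: eqP km => // ->.
- rewrite undup_id ?iota_uniq //= big_cons /vertex_wt eqxx.
  rewrite (eq_big_seq (fun k => (1 - phat) * rhat t k)); last first.
    by move=> k; rewrite mem_iota add1n ltnS => /andP[k1 ->]; rewrite gtn_eqF.
  have := rhat_sum ht; rewrite -big_distrr /= /index_iota subn1 /= => ->.
  by rewrite mulr1 addrC subrK.
Qed.

Lemma newtype_valid s b : (1 <= s <= sigma)%N ->
  (newtype s b = Src \/ exists2 s', (1 <= s' <= sigma)%N & newtype s b = Chg s').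
Proof.
move=> hs; rewrite /newtype; case: ifP => _; first by right; exists s.
by case: b; [left | right; exists sigma => //; rewrite leqnn (leq_trans _ sigma_ge2)].
Qed.

Lemma subdist_pos st b : subdist (pos_wt st (urgent st) b).
Proof.
have s1 : (1 <= sigma)%N by exact: ltnW.
have hs := urgent_charge st s1; rewrite /pos_wt; case: (_ < _)%N.
  case hk: (1 <= vkap st (urgent st).1 <= m)%N; last exact: subdist_zero.
  case: (_ && _); last by apply: (subdist_supp (t := A (urgent st).2 (vkap st (urgent st).1))); eauto.
  by apply: (subdist_supp (t := Delta_list sigma A (vkap st (urgent st).1))); eauto.
have ss : (1 <= sigma <= sigma)%N by rewrite s1 leqnn.
by case: b; apply: subdist_maxw; eauto.
Qed.

Lemma subdist_star s : subdist (star_wt s).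
Proof.
rewrite /star_wt; case: (_ < _)%N; first exact: subdist_delta.
apply: (@subdist_supp _ _ _ [:: true; false]) => [[]|[]|] //=; first by rewrite subr_ge0.
by rewrite big_cons big_seq1 addrC subrK.
Qed.

(** Three successive draws: the star, the jump given the star, and the decoration given the site
    reached. *)
Lemma subdist_kernel st : subdist (kernel st).
Proof.
have s1 : (1 <= sigma)%N by exact: ltnW.
rewrite /kernel; case: (_ == _).
  apply: (@subdist_prod _ _ _ (fun y => (y == (false, unit))%:R) (fun _ => vertex_wt (Chg 1))).
    exact: subdist_delta.
  by move=> _; apply: subdist_vertex; right; exists 1%N; rewrite ?s1.
apply: (@subdist_prod _ _ _
  (fun y => star_wt (urgent st).2 y.1 * pos_wt st (urgent st) y.1 y.2)
  (fun y => kap_wt st (newpos st (urgent st) y.2) (newtype (urgent st).2 y.1))).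
  apply: (@subdist_prod _ _ _ (star_wt _)) => *; first exact: subdist_star.
  exact: subdist_pos.
move=> y; rewrite /kap_wt; case: (_ \in _); first exact: subdist_delta.
by apply: subdist_vertex; apply: newtype_valid; apply: urgent_charge.
Qed.

End Weights.
End Exploration.


(** * Local structure of decorated Toom contours *)

Lemma count_le1_inj (T : eqType) (P : pred T) (l : seq T) x y :
  (count P l <= 1)%N -> x \in l -> y \in l -> P x -> P y -> x = y.
Proof.
move=> c xl yl Px Py; have : x \in filter P l by rewrite mem_filter Px.
have : y \in filter P l by rewrite mem_filter Py.
move: c; rewrite -size_filter; case: (filter P l) => [|a [|b l']] //= _.
by rewrite !inE => /eqP-> /eqP->.
Qed.

(** A path from [u] to any other vertex starts with an edge at [u]. *)
Lemma connected_incident G u : tconnected G -> (1 < nv G)%N -> (u < nv G)%N ->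
  exists2 e, e \in te G & e.1.1 = u \/ e.1.2 = u.
Proof.
move=> cG n1 un.
have [w wu] : exists w : 'I_(nv G), w != Ordinal un.
  have n0 : (0 < nv G)%N by exact: ltnW.
  case: (posnP u) => [u0|u0]; first by exists (Ordinal n1); rewrite -val_eqE /= u0.
  by exists (Ordinal n0); rewrite -val_eqE /= neq_ltn u0.
have /connectP[[|y p] /= + ew] := cG (Ordinal un) w; first by rewrite ew eqxx in wu.
case/andP=> /hasP[e eG /orP[]/andP[/eqP a /eqP b]] _; exists e => //; first by left.
by right.
Qed.

Section Relabel.
Context {L : Type} (D : dcontour L) (f : 'I_(dN D) -> nat) (f_inj : injective f).

Lemma tv_relabel v t : tv (relabel D f) (f v) t = dtv D v t.
Proof.
apply/existsP/idP => [[w /andP[/eqP/f_inj-> //]]|vt].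
by exists v; rewrite eqxx.
Qed.

Lemma outdeg_relabel v s : outdeg (relabel D f) (f v) s =
  count (fun e => (e.1.1 == v) && (e.2 == s)) (dte D).
Proof.
by rewrite /outdeg /= count_map; apply: eq_count => e /=; rewrite inj_eq.
Qed.

Lemma indeg_relabel v s : indeg (relabel D f) (f v) s =
  count (fun e => (e.1.2 == v) && (e.2 == s)) (dte D).
Proof.
by rewrite /indeg /= count_map; apply: eq_count => e /=; rewrite inj_eq.
Qed.

Lemma relabel_edge_inj :
  injective (fun e : 'I_(dN D) * 'I_(dN D) * nat => (f e.1.1, f e.1.2, e.2)).
Proof. by move=> [[a b] c] [[a' b'] c'] [/f_inj-> /f_inj-> ->]. Qed.

Lemma mem_relabel v w s : ((f v, f w, s) \in te (relabel D f)) = ((v, w, s) \in dte D).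
Proof. exact: (mem_map relabel_edge_inj _ (v, w, s)). Qed.
End Relabel.

Section Contour.
Context {L : countType} (mul : L -> L -> L) (inv : L -> L) (unit : L) (sigma m : nat).
Variables (A : nat -> nat -> seq L) (D : dcontour L).
Hypothesis sigma_ge2 : (2 <= sigma)%N.
Hypothesis HD : in_D0 mul inv unit sigma m A D.

Definition dout v s := count (fun e : 'I_(dN D) * 'I_(dN D) * nat => (e.1.1 == v) && (e.2 == s)) (dte D).
Definition din v s := count (fun e : 'I_(dN D) * 'I_(dN D) * nat => (e.1.2 == v) && (e.2 == s)) (dte D).

Let psi := dpsi D.
Let kap := dkappa D.

Lemma D_dout (v : 'I_(dN D)) s : outdeg (underlying D) v s = dout v s.
Proof. exact: outdeg_relabel (@ord_inj _) v s. Qed.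
Lemma D_din (v : 'I_(dN D)) s : indeg (underlying D) v s = din v s.
Proof. exact: indeg_relabel (@ord_inj _) v s. Qed.
Lemma D_tv (v : 'I_(dN D)) t : tv (underlying D) v t = dtv D v t.
Proof. exact: tv_relabel (@ord_inj _) v t. Qed.

Lemma D_uniq : uniq (dte D).
Proof.
by case: HD => [[[[+ _] _] _] _ _ _ _]; rewrite /= map_inj_uniq //; apply: relabel_edge_inj; apply: ord_inj.
Qed.

Lemma D_range e : e \in dte D -> (1 <= e.2 <= sigma)%N.
Proof.
by case: HD => [[[[_ [H _]] _] _] _ _ _ _] eD; case: (H _ (map_f _ eD)).
Qed.

Lemma D_type v : exists t, valid_type sigma t /\ dtv D v t.
Proof.
case: HD => [[[[_ [_ [H _]]] _] _] _ _ _ _]; have [t []] := H v (ltn_ord v).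
by rewrite D_tv; exists t.
Qed.

Lemma D_chg_range v s : dtv D v (Chg s) -> (1 <= s <= sigma)%N.
Proof.
case: HD => [[[[_ [_ [_ H]]] _] _] _ _ _ _]; rewrite -D_tv; exact/H/ltn_ord.
Qed.

Lemma D_root : dtv D (droot D) Src.
Proof. by case: HD => [[_ ->]]. Qed.

Lemma D_src v : dtv D v Src -> (forall s, din v s = 0%N) /\
  (exists d, (d <= 1)%N /\ forall s, (1 <= s <= sigma)%N -> dout v s = d).
Proof.
case: HD => [[[_ H] _] _ _ _ _]; case: (H v (ltn_ord v)); rewrite D_tv => + _ _ _ vS.
move=> /(_ vS)[a [d [d1 b]]]; split=> [s|]; first by rewrite -D_din.
by exists d; split=> // s; rewrite -D_dout; apply: b.
Qed.

Lemma D_src_snk v : dtv D v Src -> (forall s, dout v s = 0%N) -> dtv D v Snk.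
Proof.
case: HD => [[[_ H] _] _ _ _ _]; case: (H v (ltn_ord v)); rewrite !D_tv => _ + _ _ vS d0.
by apply => // s; rewrite D_dout.
Qed.

Lemma D_snk v : dtv D v Snk -> (forall s, dout v s = 0%N) /\
  (exists d, (d <= 1)%N /\ forall s, (1 <= s <= sigma)%N -> din v s = d).
Proof.
case: HD => [[[_ H] _] _ _ _ _]; case: (H v (ltn_ord v)); rewrite !D_tv => _ _ + _ vS.
move=> /(_ vS)[a [d [d1 b]]]; split=> [s|]; first by rewrite -D_dout.
by exists d; split=> // s; rewrite -D_din; apply: b.
Qed.

Lemma D_chg v s : dtv D v (Chg s) -> [/\ din v s = 1%N, dout v s = 1%N &
             forall s', s' != s -> din v s' = 0%N /\ dout v s' = 0%N].
Proof.
case: HD => [[[_ H] _] _ _ _ _]; case: (H v (ltn_ord v)) => _ _ _ /(_ s).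
rewrite D_tv D_din D_dout => h /h[-> -> h']; split=> // s' /h'.
by rewrite D_din D_dout.
Qed.

Lemma D_snk_sep v w : dtv D v Snk -> psi v = psi w -> v = w.
Proof.
case: HD => [_ _ [H _] _ _] vS vw; apply/eqP; apply: contraT => /(H _ _ vS).
by rewrite -/psi vw eqxx.
Qed.

Lemma D_inj s v w : (1 <= s <= sigma)%N ->
          (dtv D v (Chg s) || (v == droot D)) -> (dtv D w (Chg s) || (w == droot D)) ->
          psi v = psi w -> v = w.
Proof. by case: HD => [_ _ [_ H] _ _]; apply: H. Qed.

Lemma D_unit : psi (droot D) = unit.
Proof. by case: HD. Qed.

Lemma D_kap_le v : (kap (psi v) <= m)%N.
Proof. by case: HD => _ _ _ _ []. Qed.

Lemma dout_gt0 v w s : (v, w, s) \in dte D -> (0 < dout v s)%N.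
Proof. by move=> eD; rewrite -has_count; apply/hasP; exists (v, w, s); rewrite //= !eqxx. Qed.
Lemma din_gt0 v w s : (v, w, s) \in dte D -> (0 < din w s)%N.
Proof. by move=> eD; rewrite -has_count; apply/hasP; exists (v, w, s); rewrite //= !eqxx. Qed.

Lemma dout_edge v s : (0 < dout v s)%N -> exists w, (v, w, s) \in dte D.
Proof. by rewrite -has_count => /hasP[[[a w] b] eD /andP[/eqP <- /eqP <-]]; exists w. Qed.

Lemma D_edge_src v w s : (v, w, s) \in dte D -> dtv D v Src || dtv D v (Chg s).
Proof.
move=> /dout_gt0 o; have [[||s'] [_ vt]] := D_type v; first by rewrite vt.
  by have [/(_ s) o0 _] := D_snk vt; rewrite o0 in o.
have [_ _ /(_ s)] := D_chg vt; case: eqVneq => [->|_ /(_ isT)[_ o0]]; first by rewrite vt orbT.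
by rewrite o0 in o.
Qed.

Lemma D_edge_tgt v w s : (v, w, s) \in dte D -> dtv D w Snk || dtv D w (Chg s).
Proof.
move=> /din_gt0 o; have [[||s'] [_ vt]] := D_type w; last 1 first.
- have [_ _ /(_ s)] := D_chg vt; case: eqVneq => [->|_ /(_ isT)[o0 _]]; first by rewrite vt orbT.
  by rewrite o0 in o.
- by have [/(_ s) o0 _] := D_src vt; rewrite o0 in o.
- by rewrite vt.
Qed.

Lemma src_not_chg v s : dtv D v Src -> dtv D v (Chg s) -> False.
Proof. by move=> /D_src[/(_ s) a _] /D_chg[]; rewrite a. Qed.
Lemma snk_not_chg v s : dtv D v Snk -> dtv D v (Chg s) -> False.
Proof. by move=> /D_snk[/(_ s) a _] /D_chg[_]; rewrite a. Qed.
Lemma chg_chg v s s' : dtv D v (Chg s) -> dtv D v (Chg s') -> s = s'.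
Proof.
move=> /D_chg[_ _ h] /D_chg[o _ _]; apply/eqP; apply: contraT; rewrite eq_sym => /h[].
by rewrite o.
Qed.

(** Such a vertex would have neither incoming nor outgoing edges, which connectedness excludes. *)
Lemma src_not_snk v : (1 < dN D)%N -> dtv D v Src -> dtv D v Snk -> False.
Proof.
move=> n1 /D_src[i0 _] /D_snk[o0 _]; case: HD => _ cG _ _ _.
have [e /mapP[[[a b] s] eD ->] /= [/ord_inj av|/ord_inj bv]] := connected_incident cG n1 (ltn_ord v).
  by have := dout_gt0 eD; rewrite av o0.
by have := din_gt0 eD; rewrite bv i0.
Qed.

(** The common out-degree is 0 or 1, and the value 0 would make the source a sink by the convention
    on trivial graphs. *)
Lemma dout_src v s : ~~ dtv D v Snk -> dtv D v Src -> (1 <= s <= sigma)%N -> dout v s = 1%N.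
Proof.
move=> nS vS hs; have [_ [d [d1 ds]]] := D_src vS; rewrite (ds _ hs).
case: d d1 ds => [|[]] // _ ds; case/negP: nS; apply: D_src_snk => // s'.
apply/eqP; rewrite -leqn0 leqNgt; apply/negP => /[dup] o /dout_edge[w /D_range/ds].
by move=> o0; rewrite o0 in o.
Qed.

Lemma dout_le1 v s : (dout v s <= 1)%N.
Proof.
rewrite leqNgt; apply/negP => o; have [w eD] := dout_edge (ltnW o).
have hs := D_range eD; case/orP: (D_edge_src eD) => [/D_src[_ [d [d1 /(_ _ hs) ds]]]|/D_chg[_ ds _]].
  by rewrite ds ltnNge d1 in o.
by rewrite ds in o.
Qed.

Lemma din_le1 v s : (din v s <= 1)%N.
Proof.
rewrite leqNgt; apply/negP => /[dup] o; move=> /ltnW; rewrite -has_count.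
move=> /hasP[[[w a] b] eD /andP[/= /eqP ea /eqP eb]]; rewrite ea eb in eD.
have hs := D_range eD; case/orP: (D_edge_tgt eD) => [/D_snk[_ [d [d1 /(_ _ hs) ds]]]|/D_chg[ds _ _]].
  by rewrite ds ltnNge d1 in o.
by rewrite ds in o.
Qed.

Lemma D_out_uniq v w w' s : (v, w, s) \in dte D -> (v, w', s) \in dte D -> w = w'.
Proof.
by move=> a b; suff [] : (v, w, s) = (v, w', s) by []; apply: count_le1_inj (dout_le1 v s) a b _ _; rewrite /= !eqxx.
Qed.

Lemma D_in_uniq v v' w s : (v, w, s) \in dte D -> (v', w, s) \in dte D -> v = v'.
Proof.
by move=> a b; suff [] : (v, w, s) = (v', w, s) by []; apply: count_le1_inj (din_le1 w s) a b _ _; rewrite /= !eqxx.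
Qed.

(* Sources may share a position, so the injectivity of psi on the edges of a
   given charge has to come from their end points. *)
Lemma D_edge_inj v v' w w' s : (v, w, s) \in dte D -> (v', w', s) \in dte D ->
  psi w = psi w' -> (v, w) = (v', w').
Proof.
move=> eD eD' ww'; suff ew : w = w' by rewrite ew in eD *; rewrite (D_in_uniq eD eD').
case/orP: (D_edge_tgt eD) => [/D_snk_sep|ws]; first exact.
case/orP: (D_edge_tgt eD') => [/D_snk_sep|ws']; first by move=> h; rewrite (h w).
by apply: (D_inj (D_range eD)); rewrite ?ws ?ws'.
Qed.

(** Membership in the circled edges; by [D_bul] all other edges are bulleted. *)
Definition cir (e : 'I_(dN D) * 'I_(dN D) * nat) := dtv D e.1.1 Src && (e.1.1 != droot D).

Lemma D_bul e : e \in dte D -> dtv D e.1.1 (Chg e.2) || (e.1.1 == droot D) = ~~ cir e.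
Proof.
case: e => [[v w] s] /= /D_edge_src; rewrite /cir /=.
case: (boolP (dtv D v Src)) => [vS _|vS /= ->] //=; rewrite negbK.
by case: (boolP (dtv D v (Chg s))) => // /(src_not_chg vS).
Qed.

(** For a circled edge the charge [s] is extracted from the union [Delta_list] and may differ from
    the charge of the edge. *)
Lemma D_edge_dec e : e \in dte D ->
  exists s k, [/\ (1 <= s <= sigma)%N, (1 <= k <= m)%N, kap (psi e.1.1) = k &
    mul (inv (psi e.1.1)) (psi e.1.2) \in A s k].
Proof.
move=> eD; have := D_bul eD; case: HD => _ _ _ _ [_ _ /(_ _ eD)[b c]].
have kl := D_kap_le e.1.1; case: (boolP (cir e)) => [ce _|_ be].
  have /andP[k1 /flatten_mapP[s hs ja]] := c ce.
  exists s, (kap (psi e.1.1)); rewrite kl k1; split=> //; move: hs.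
  by rewrite mem_iota add1n ltnS.
have /andP[k1 ja] := b be; exists e.2, (kap (psi e.1.1)); rewrite kl k1; split=> //.
exact: D_range.
Qed.

(** A vertex that is not a sink has an outgoing edge, and the decoration at the start of an edge is
    at least 1. *)
Lemma D_kap0 v : (kap (psi v) == 0%N) = dtv D v Snk.
Proof.
apply/eqP/idP => [k0|]; last by case: HD => _ _ _ _ [_ H _]; apply: H.
apply: contraT => nS; have [s o] : exists s, (0 < dout v s)%N.
  have [[||s] [_ vt]] := D_type v; last by exists s; case: (D_chg vt) => _ ->.
    by exists 1%N; rewrite dout_src //= ltnW.
  by rewrite vt in nS.
have [w /D_edge_dec[s' [k [_ k1 /= kk _]]]] := dout_edge o; by rewrite -kk k0 in k1.
Qed.

Lemma D_trivial : dN D = 1%N -> dte D = [::].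
Proof.
move=> n1; case: (dte D) (@din_gt0) => // [[[v w] s] l] H.
have := H v w s (mem_head _ _); have -> : w = droot D.
  by apply: ord_inj; move: (ltn_ord w) (ltn_ord (droot D)); rewrite {2 4}n1; case: (w : nat) (droot D : nat) => [|?] [|?].
by have [-> _] := D_src D_root.
Qed.

(** Selects one type per vertex. The choice matters only for the trivial contour, where [Src] wins
    over [Snk]. *)
Definition vt v := if dtv D v Src then Src else if dtv D v Snk then Snk
  else Chg (nth 0%N [seq s <- iota 1 sigma | dtv D v (Chg s)] 0%N).

Lemma dtv_vt v : dtv D v (vt v).
Proof.
rewrite /vt; case: ifP => // nS; case: ifP => // nK.
have [[||s] [/= hs vs]] := D_type v; rewrite ?vs // in nS nK *.
have : s \in [seq s <- iota 1 sigma | dtv D v (Chg s)].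
  by rewrite mem_filter vs mem_iota add1n ltnS.
case E: [seq s <- iota 1 sigma | dtv D v (Chg s)] => [|a l] // _ /=.
by have := mem_head a l; rewrite -E mem_filter => /andP[].
Qed.

Lemma dtvE v t : (1 < dN D)%N -> dtv D v t = (t == vt v).
Proof.
move=> n1; apply/idP/eqP => [|->]; last exact: dtv_vt.
move: (dtv_vt v); case: (vt v) t => [||s] [||s'] // a b.
- by case: (src_not_snk n1 a b).
- by case: (src_not_chg a b).
- by case: (src_not_snk n1 b a).
- by case: (snk_not_chg a b).
- by case: (src_not_chg b a).
- by case: (snk_not_chg b a).
- by rewrite (chg_chg a b).
Qed.

Lemma dtv1 v t : dN D = 1%N -> dtv D v t = if t is Chg _ then false else true.
Proof.
move=> n1; have -> : v = droot D.
  by apply: ord_inj; move: (ltn_ord v) (ltn_ord (droot D)); rewrite {2 4}n1; case: (v : nat) (droot D : nat) => [|?] [|?].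
case: t => [||s]; first exact: D_root.
  by apply: D_src_snk D_root _ => s; rewrite /dout D_trivial.
by apply/negP => /(src_not_chg D_root).
Qed.

End Contour.


(** * Factorisation of [nu] over first visits and edges *)

Section ContourWeight.
Context {R : realFieldType} {L : countType} (mul : L -> L -> L) (unit : L) (inv : L -> L).
Hypothesis mulA : forall x y z, mul x (mul y z) = mul (mul x y) z.
Hypothesis mul1x : forall x, mul unit x = x.
Hypothesis mulxV : forall x, mul x (inv x) = unit.
Context (h : L -> int) (hM : forall x y, h (mul x y) = h x + h y).
Context (sigma m : nat) (sigma_ge2 : (2 <= sigma)%N) (A : nat -> nat -> seq L).
Hypothesis A_h : forall s k, (1 <= s <= sigma)%N -> (1 <= k <= m)%N ->
           all (fun i => h i == 1) (A s k).
Variables (abul acir : nat -> nat -> L -> R) (rhat : vtype -> nat -> R) (phat pcir : R).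
Variable (D : dcontour L).
Hypothesis HD : in_D0 mul inv unit sigma m A D.
Variable (eta : 'I_(dN D) -> 'I_(dN D)) (eta_inj : injective eta).

Let psi := dpsi D.
Let kap := dkappa D.

Lemma D_edge_h e : e \in dte D -> h (psi e.1.2) = h (psi e.1.1) + 1.
Proof.
move=> /(D_edge_dec HD)[s [k [hs hk _ jA]]].
have /eqP <- := allP (A_h hs hk) _ jA.
by rewrite -hM mulA mulxV mul1x.
Qed.

Lemma sum_edges_tgt (F : 'I_(dN D) -> int) s :
  \sum_(e <- dte D | e.2 == s) F e.1.2 = \sum_v F v *+ din v s.
Proof.
rewrite (partition_big (fun e : 'I_(dN D) * 'I_(dN D) * nat => e.1.2) xpredT) //=.
apply: eq_bigr => v _; rewrite (eq_bigr (fun=> F v)) => [|e /andP[_ /eqP->] //].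
by rewrite big_const_seq iter_addr_0; congr (_ *+ _); apply: eq_count => e; rewrite andbC.
Qed.

Lemma sum_edges_src (F : 'I_(dN D) -> int) s :
  \sum_(e <- dte D | e.2 == s) F e.1.1 = \sum_v F v *+ dout v s.
Proof.
rewrite (partition_big (fun e : 'I_(dN D) * 'I_(dN D) * nat => e.1.1) xpredT) //=.
apply: eq_bigr => v _; rewrite (eq_bigr (fun=> F v)) => [|e /andP[_ /eqP->] //].
by rewrite big_const_seq iter_addr_0; congr (_ *+ _); apply: eq_count => e; rewrite andbC.
Qed.

(* Both sides are the sum over the edges of the increments of h, in which the
   vertices of V_s cancel. *)
Lemma count_charge s s' : (1 <= s <= sigma)%N -> (1 <= s' <= sigma)%N ->
  count (fun e => e.2 == s) (dte D) = count (fun e => e.2 == s') (dte D).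
Proof.
have E c : (count (fun e => e.2 == c) (dte D))%:Z
    = \sum_v (h (psi v) *+ din v c - h (psi v) *+ dout v c).
  have := sum_edges_tgt (fun v => h (psi v)) c; have := sum_edges_src (fun v => h (psi v)) c.
  move=> /= Es Et; rewrite sumrB -Es -Et -sumrB -natz -sum1_count natr_sum.
  rewrite big_seq_cond [RHS]big_seq_cond; apply: eq_bigr => e /andP[eD _].
  by rewrite (D_edge_h eD) addrAC subrr add0r.
move=> hs hs'; apply/eqP; rewrite -eqz_nat !E; apply/eqP; apply: eq_bigr => v _.
have [[||c] [_ vt]] := D_type HD v.
- by have [i [d [_ o]]] := D_src HD vt; rewrite !i !o.
- by have [o [d [_ i]]] := D_snk HD vt; rewrite !o !i.
have [i o io] := D_chg HD vt.
have z a : h (psi v) *+ din v a - h (psi v) *+ dout v a = 0.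
  by case: (eqVneq a c) => [->|/io[-> ->]]; rewrite ?i ?o subrr.
by rewrite !z.
Qed.

(** Both sides add up the out-degrees of the sources other than the root, which are the same for
    every charge. *)
Lemma count_cir s s' : (1 <= s <= sigma)%N -> (1 <= s' <= sigma)%N ->
  count (fun e => (e.2 == s) && cir e) (dte D) = count (fun e => (e.2 == s') && cir e) (dte D).
Proof.
have E c : count (fun e => (e.2 == c) && cir e) (dte D)
    = (\sum_(v | dtv D v Src && (v != droot D)) dout v c)%N.
  rewrite -sum1_count (partition_big (fun e : 'I_(dN D) * 'I_(dN D) * nat => e.1.1)
    (fun v => dtv D v Src && (v != droot D))) => [|e /andP[_] //].
  apply: eq_bigr => v vr; rewrite sum1_count; apply: eq_count => e /=.
  by rewrite /cir; case: (eqVneq e.1.1 v) => [->|_]; rewrite ?vr ?andbT ?andbF.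
move=> hs hs'; rewrite !E; apply: eq_bigr => v /andP[vS _].
by have [_ [d [_ o]]] := D_src HD vS; rewrite !o.
Qed.

(** Subtract [count_cir] from [count_charge]. *)
Lemma count_bul s s' : (1 <= s <= sigma)%N -> (1 <= s' <= sigma)%N ->
  count (fun e => (e.2 == s) && ~~ cir e) (dte D) = count (fun e => (e.2 == s') && ~~ cir e) (dte D).
Proof.
move=> hs hs'; have := count_charge hs hs'.
have E c : count (fun e => e.2 == c) (dte D) =
   (count (fun e => (e.2 == c) && cir e) (dte D) + count (fun e => (e.2 == c) && ~~ cir e) (dte D))%N.
  rewrite -[LHS]sum1_count (bigID (fun e => cir e)) /=.
  by rewrite !sum1_count.
by rewrite !E (count_cir hs hs') => /addnI.
Qed.

(** The vertices f(i) of the type function, one for each site of the image of [psi]. *)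
Definition first v := [forall w, (psi w == psi v) ==> (nat_of_ord (eta v) <= eta w)%N].

Lemma tau_first v : first v -> tau sigma D eta (psi v) = tau' sigma D v.
Proof.
move=> /forallP fv; rewrite /tau; case: pickP => [w /andP[/eqP wv /forallP fw]|/(_ v)].
  congr tau'; apply: eta_inj; apply: ord_inj; apply/eqP; rewrite eqn_leq.
  by move: (implyP (fv w)) (implyP (fw v)); rewrite /psi wv eqxx => -> // ->.
by rewrite eqxx /= => /negP[]; apply/forallP.
Qed.

Lemma first_snk v : dtv D v Snk -> first v.
Proof. by move=> vS; apply/forallP => w; apply/implyP => /eqP/esym/(D_snk_sep HD vS) ->. Qed.

Lemma first_ex v : exists w, first w /\ psi w = psi v.
Proof.
have [w /eqP wv wm] := arg_minnP (P := fun w => psi w == psi v) (fun w => eta w : nat) (eqxx _).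
by exists w; split=> //; apply/forallP => u; apply/implyP => uw; apply: wm; rewrite -wv.
Qed.

Definition edge_jump (e : 'I_(dN D) * 'I_(dN D) * nat) := mul (inv (psi e.1.1)) (psi e.1.2).
Definition jump_wt (e : 'I_(dN D) * 'I_(dN D) * nat) : R :=
  (if cir e then acir else abul) e.2 (kap (psi e.1.1)) (edge_jump e).
(** The factors in p and B sit on the charge-[sigma] edges, where the exploration pays them, rather
    than on charge 1 as in [nu]. *)
Definition edge_wt (e : 'I_(dN D) * 'I_(dN D) * nat) : R :=
  jump_wt e * (if e.2 == sigma then
     if cir e then pcir / Bcir sigma m A acir else (1 - pcir) / Bbul sigma m A abul else 1).

(** By [D_edge_inj], distinct edges of one charge have distinct images, so the removal of duplicates
    changes nothing. *)
Lemma prod_pairs (Q : pred ('I_(dN D) * 'I_(dN D) * nat)) s (F : L * L -> R) :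
  \prod_(p <- undup [seq (psi e.1.1, psi e.1.2) | e <- [seq e <- dte D | (e.2 == s) && Q e]]) F p =
  \prod_(e <- dte D | (e.2 == s) && Q e) F (psi e.1.1, psi e.1.2).
Proof.
rewrite undup_id ?big_map ?big_filter // map_inj_in_uniq ?filter_uniq ?(D_uniq HD) //.
move=> [[v w] c] [[v' w'] c']; rewrite !mem_filter /= => /andP[/andP[/eqP-> _] eD] /andP[/andP[/eqP-> _] eD'].
by move=> [_ /(D_edge_inj HD eD eD')[-> ->]].
Qed.

(** Sites correspond to first visits, and pairs of sites to edges; equality of the edge numbers
    moves the factors in p and B from charge 1 to charge [sigma]. *)
Lemma nuE :
  nu mul inv sigma m A abul acir rhat phat pcir D eta =
  (\prod_(v | first v) vertex_wt m rhat phat (tau' sigma D v) (kap (psi v)))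
  * \prod_(e <- dte D) edge_wt e.
Proof.
have s1 : (1 <= 1 <= sigma)%N by rewrite leqnn ltnW.
have ss : (1 <= sigma <= sigma)%N by rewrite leqnn ltnW.
rewrite /nu; lazy zeta; rewrite -/psi -/kap.
have EE s : [seq e <- dte D | (e.2 == s) && (dtv D e.1.1 (Chg s) || (e.1.1 == droot D))]
    = [seq e <- dte D | (e.2 == s) && ~~ cir e].
  apply: eq_in_filter => e eD; case: eqP => // <- /=; exact: (D_bul HD).
rewrite (EE 1%N).
set imgS := [seq psi v | v <- _ & dtv D v Snk].
set imgNS := undup _.
have mS v : (psi v \in imgS) = dtv D v Snk.
  apply/mapP/idP => [[w]|vS]; last by exists v; rewrite // mem_filter vS mem_enum.
  by rewrite mem_filter => /andP[wS _] /esym/(D_snk_sep HD wS) <-.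
(* Each site that is not the image of a sink is listed once, through its first visit. *)
have imgP : perm_eq imgNS [seq psi v | v <- enum 'I_(dN D) & first v && ~~ dtv D v Snk].
  apply: uniq_perm; first exact: undup_uniq.
    rewrite map_inj_in_uniq => [|v w]; first exact: filter_uniq (enum_uniq _).
    rewrite !mem_filter => /andP[/andP[/forallP fv _] _] /andP[/andP[/forallP fw _] _] vw.
    apply: eta_inj; apply: ord_inj; apply/eqP; rewrite eqn_leq.
    by move: (implyP (fv w)) (implyP (fw v)); rewrite vw eqxx => -> // ->.
  move=> i; rewrite mem_undup; apply/mapP/mapP => -[v]; rewrite mem_filter.
    rewrite mS => /andP[nS _] ->; have [w [fw wv]] := first_ex v; exists w => //.
    by rewrite mem_filter fw mem_enum -mS wv mS nS.
  by move=> /andP[/andP[fv nS] _] ->; exists v; rewrite // mem_filter mS nS mem_enum.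
have -> : \prod_(v | first v) vertex_wt m rhat phat (tau' sigma D v) (kap (psi v)) =
   phat ^+ #|[pred v | dtv D v Snk]| * (1 - phat) ^+ size imgNS
   * \prod_(i <- imgNS) rhat (tau sigma D eta i) (kap i).
  rewrite (bigID (fun v => dtv D v Snk)) /= -mulrA; congr (_ * _).
    rewrite (eq_bigl (fun v => dtv D v Snk)) => [|v].
      rewrite (eq_bigr (fun=> phat)) ?prodr_const // => v vS.
      by rewrite /vertex_wt (D_kap0 sigma_ge2 HD) vS.
    by case: (boolP (dtv D v Snk)) => [/first_snk ->|_]; rewrite ?andbF.
  rewrite -iter_mulr_1 -count_predT -big_const_seq -big_split /= (perm_big _ imgP) big_map big_filter big_enum_cond /=.
  apply: eq_bigr => v /andP[fv nS].
  by rewrite /vertex_wt (D_kap0 sigma_ge2 HD) (negPf nS) (D_kap_le HD) tau_first.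
rewrite -!mulrA; do 3 congr (_ * _).
rewrite /edge_wt [RHS]big_split /=; congr (_ * _).
  transitivity (\prod_(1 <= s < sigma.+1) \prod_(e <- dte D | e.2 == s) jump_wt e).
    apply: eq_bigr => s _; rewrite EE.
    rewrite (prod_pairs _ _ (fun p => acir s (kap p.1) (mul (inv p.1) p.2))).
    rewrite (prod_pairs _ _ (fun p => abul s (kap p.1) (mul (inv p.1) p.2))) /=.
    rewrite [RHS](bigID (fun e => cir e)) /=.
    congr (_ * _); apply: eq_bigr => e /andP[/eqP es ce]; rewrite /jump_wt /edge_jump es.
      by rewrite (ce : cir e).
    by rewrite (negPf ce).
  rewrite (exchange_big_dep xpredT) //=; apply: eq_big_seq => e eD.
  rewrite -big_filter (eq_filter (a2 := pred1 e.2)) => [|x /=]; last exact: eq_sym.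
  rewrite filter_pred1_uniq ?iota_uniq ?big_seq1 //.
  by rewrite mem_index_iota ltnS (D_range HD eD).
(* What remains are powers whose exponents count charge-[sigma] edges; [count_cir] and [count_bul]
   turn them into the exponents of [nu]. *)
rewrite -big_mkcond (bigID (fun e => cir e)) /=.
rewrite (eq_bigr (fun=> pcir / Bcir sigma m A acir)) => [|e /andP[_ ->] //].
rewrite [X in _ = _ * X](eq_bigr (fun=> (1 - pcir) / Bbul sigma m A abul)) => [|e /andP[_ /negPf->] //].
rewrite !big_const_seq !iter_mulr_1 !size_filter (count_cir s1 ss) (count_bul s1 ss).
rewrite !exprMn; set x := _ ^+ _; set y := _ ^+ _; set z := _ ^+ _; set t := _ ^+ _.
by rewrite [z * x]mulrC -!mulrA; congr (_ * _); rewrite mulrCA [y * t]mulrC.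
Qed.
End ContourWeight.


(** * The stages of the natural order inside a contour *)

Lemma loose_end_congr sigma G H v s : nv G = nv H ->
  (forall u t, (u < nv G)%N -> tv G u t = tv H u t) -> perm_eq (te G) (te H) ->
  loose_end sigma G v s = loose_end sigma H v s.
Proof.
move=> nGH tGH eGH; rewrite /loose_end -nGH; case: ltnP => //= vn.
by rewrite !tGH // /outdeg /indeg !(permP eGH).
Qed.

(** In the connected graph [H] every new vertex meets an edge, and only the added edge is available.
    Its end [v] is old, so [w] is the only possible new vertex. *)
Lemma extension_new_vertex sigma G H v s w :
  tconnected H -> (forall e, e \in te G -> e.1.1 < nv G /\ e.1.2 < nv G)%N ->
  (0 < nv G)%N -> (v < nv G)%N -> (nv G <= nv H)%N ->
  (w < nv H)%N ->
  te H =i (if (s < sigma)%N then (v, w, s) else (w, v, sigma)) :: te G ->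
  (nv H = nv G /\ w < nv G)%N \/ (nv H = (nv G).+1 /\ w = nv G).
Proof.
move=> cH epG n0 vn nGH wn eH.
have neww u : (nv G <= u < nv H)%N -> u = w.
  move=> /andP[un uH].
  have [|e eeH eu] := connected_incident cH _ uH; first exact: leq_trans (leq_ltn_trans n0 _) uH.
  move: eeH; rewrite eH inE => /orP[/eqP ee|/epG[e1 e2]]; last first.
    by case: eu => eu; rewrite leqNgt -eu ?e1 ?e2 in un.
  have nuv : u <> v by move=> uv; rewrite uv leqNgt vn in un.
  by move: eu; rewrite ee; case: ifP => _ [] //= h; case: nuv.
have [wG|wG] := ltnP w (nv G).
  left; split=> //; apply/eqP; rewrite eqn_leq nGH andbT leqNgt; apply/negP => lt.
  by have := neww (nv G); rewrite leqnn lt => /(_ isT) ew; rewrite ew ltnn in wG.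
have wE : w = nv G by rewrite (neww (nv G)) // leqnn (leq_ltn_trans wG).
right; split=> //; apply/eqP; rewrite eqn_leq -{2}wE wn andbT leqNgt; apply/negP => lt.
by have := neww (nv G).+1; rewrite leqnSn lt wE => /(_ isT) /eqP; rewrite gtn_eqF.
Qed.

Section Labelling.
Context {L : countType} (mul : L -> L -> L) (inv : L -> L) (unit : L).
Context (sigma m : nat) (A : nat -> nat -> seq L).
Hypothesis sigma_ge2 : (2 <= sigma)%N.
Variables (D : dcontour L) (eta : 'I_(dN D) -> 'I_(dN D)).
Hypothesis HD : in_D0 mul inv unit sigma m A D.
Hypothesis eta_inj : injective eta.
Hypothesis eta_root : nat_of_ord (eta (droot D)) = 0%N.

Let psi := dpsi D.
Let kap := dkappa D.

Definition lab (v : 'I_(dN D)) : nat := eta v.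
(** Inverse of [lab], made total by an arbitrary value at ranks that do not occur. *)
Definition vert (i : nat) : 'I_(dN D) := invF eta_inj (insubd (droot D) i).

Lemma labK v : vert (lab v) = v.
Proof.
rewrite /vert (_ : insubd _ _ = eta v) ?(invF_f eta_inj) //.
by apply: val_inj; rewrite val_insubd ltn_ord.
Qed.

Lemma vertK i : (i < dN D)%N -> lab (vert i) = i.
Proof. by move=> iN; rewrite /lab /vert (f_invF eta_inj) val_insubd iN. Qed.

Lemma lab_inj : injective lab.
Proof. exact: can_inj labK. Qed.

Lemma vert0 : vert 0 = droot D.
Proof. by rewrite -eta_root -/(lab _) labK. Qed.

Lemma vert_root i : (i < dN D)%N -> (vert i == droot D) = (i == 0%N).
Proof. by move=> iN; rewrite -vert0 -(inj_eq lab_inj) !vertK // (leq_ltn_trans _ iN). Qed.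

Lemma vert_inj i j : (i < dN D)%N -> (j < dN D)%N -> vert i = vert j -> i = j.
Proof. by move=> iN jN e; rewrite -(vertK iN) e vertK. Qed.

(** The entry that the exploration has to store at rank [i]. *)
Definition vrec i : vtype * L * nat := (vt sigma (vert i), psi (vert i), kap (psi (vert i))).
Definition vrecs n := [seq vrec i | i <- iota 0 n].

Lemma vertex_vrecs st n v : st.1 = vrecs n -> (v < n)%N -> vertex unit st v = vrec v.
Proof. by move=> stE vn; rewrite /vertex stE (nth_map 0%N) ?size_iota // nth_iota. Qed.

Lemma positions_vrecs st n : st.1 = vrecs n ->
  positions st = [seq psi (vert i) | i <- iota 0 n].
Proof. by rewrite /positions => ->; rewrite -map_comp. Qed.

Lemma mem_positions st n p : st.1 = vrecs n ->
  reflect (exists2 i, (i < n)%N & psi (vert i) = p) (p \in positions st).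
Proof.
move=> /positions_vrecs ->; apply: (iffP mapP) => -[i]; first by rewrite mem_iota add0n => ? ->; exists i.
by move=> ilt <-; exists i => //; rewrite mem_iota add0n.
Qed.

Lemma index_positions st n p : st.1 = vrecs n -> p \in positions st ->
  (index p (positions st) < n)%N /\ psi (vert (index p (positions st))) = p.
Proof.
move=> stE pp; have lt : (index p (positions st) < n)%N.
  by rewrite -index_mem in pp; move: pp; rewrite {2}(positions_vrecs stE) size_map size_iota.
split=> //; rewrite -[RHS](nth_index unit pp) {2}(positions_vrecs stE).
by rewrite (nth_map 0%N) ?size_iota // nth_iota.
Qed.

Lemma first_positions st n : (n < dN D)%N -> st.1 = vrecs n ->
  first eta (vert n) = (psi (vert n) \notin positions st).
Proof.
move=> nN stE; apply/forallP/idP => [fn|/(mem_positions _ stE) nex w].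
  apply/negP => /(mem_positions _ stE)[i iltn ipsi].
  have := implyP (fn (vert i)); rewrite /psi in ipsi; rewrite ipsi eqxx => /(_ isT).
  by rewrite -/(lab _) -/(lab (vert i)) !vertK ?(ltn_trans iltn) // leqNgt iltn.
apply/implyP => /eqP wn; rewrite -/(lab _) -/(lab w) vertK // leqNgt; apply/negP => lt.
by apply: nex; exists (lab w); rewrite // labK.
Qed.

(** [G] is a part of [D] under [vert]. The last two clauses say that an explored vertex already has
    its edge on the side from which it could be reached again; sinks and the root are exempt. *)
Definition stage (G : tgraph) : Prop :=
  [/\ (0 < nv G <= dN D)%N,
      forall u t, (u < nv G)%N -> tv G u t = (t == vt sigma (vert u)),
      uniq (te G) /\
      (forall e, e \in te G -> [/\ e.1.1 < nv G, e.1.2 < nv G & (vert e.1.1, vert e.1.2, e.2) \in dte D]%N),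
      forall v, (v < nv G)%N -> v != 0%N -> dtv D (vert v) Src || dtv D (vert v) (Chg sigma) ->
        (0 < outdeg G v sigma)%N &
      forall v s, (v < nv G)%N -> (s < sigma)%N -> dtv D (vert v) (Chg s) -> (0 < indeg G v s)%N].

(** The degree clauses come from [incomplete_toom], which every stage after the first satisfies as
    an extension; the first one is the bare root and is checked directly. *)
Lemma stages M Gs : (1 < dN D)%N ->
  tg_eq (Gs 0%N) triv_incomplete -> tg_eq (Gs M) (relabel D lab) ->
  (forall k, (k < M)%N -> exists v s,
     most_urgent sigma (Gs k) v s /\ extension sigma (Gs k) (Gs k.+1) v s) ->
  forall k, (k <= M)%N -> stage (Gs k) /\ ((0 < k)%N -> tconnected (Gs k)).
Proof.
move=> n1 G0 GM ext.
(* Inclusion in [D] is known for the last graph and is carried backwards, since an extension only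
   adds vertices, types and edges. *)
have top k : (k <= M)%N -> [/\ (nv (Gs k) <= dN D)%N,
    forall u t, (u < nv (Gs k))%N -> tv (Gs k) u t -> dtv D (vert u) t &
    forall e, e \in te (Gs k) -> (vert e.1.1, vert e.1.2, e.2) \in dte D].
  move=> kM; rewrite -(subKn kM); move: (M - k)%N (leq_subr k M) => {k kM}.
  elim=> [|k IH] kM.
    rewrite subn0; case: GM => nM tM eM; split; first by rewrite nM.
      move=> u t un; rewrite tM // => /existsP[v /andP[/eqP <- ?]].
      by rewrite labK.
    by move=> e; rewrite eM => /mapP[[[a b] c] eD ->] /=; rewrite !labK.
  have [nk tk ek] := IH (ltnW kM).
  have lt : (M - k.+1 < M)%N by rewrite ltn_subrL /= (leq_trans _ kM).
  have [v [s [_ [_ nle tle [w [_ eq]]]]]] := ext _ lt.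
  rewrite -subSn // subSS in nle tle eq *; split; first exact: leq_trans nle nk.
    by move=> u t un /(tle _ _ un) /tk; apply; apply: leq_trans nle.
  by move=> e eG; apply: ek; rewrite eq inE eG orbT.
have inG G : incomplete_toom sigma G -> (nv G <= dN D)%N ->
   (forall u t, (u < nv G)%N -> tv G u t -> dtv D (vert u) t) ->
   (forall e, e \in te G -> (vert e.1.1, vert e.1.2, e.2) \in dte D) -> stage G.
  move=> [[n0 _] [ue [ep [ty _]]] _ _ tri] nN tD eD.
  have tE u t : (u < nv G)%N -> tv G u t = (t == vt sigma (vert u)).
    move=> un; apply/idP/eqP => [/(tD _ _ un)|->]; first by rewrite (dtvE HD) // => /eqP.
    have [t' [_ tt']] := ty u un.
    by move: (tD _ _ un tt'); rewrite (dtvE HD) // => /eqP <-.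
  split=> //; first by rewrite n0.
  - by split=> // e eG; have [? ? _] := ep _ eG; split; rewrite ?eD.
  - move=> v vn v0 vt'; case: tri => [[nv1 _ _ _ _]|/(_ v vn)[h _ _]].
      by move: vn v0; rewrite nv1; case: v {vt'}.
    by apply: h => //; rewrite !tE // -!(dtvE HD) // orbC.
  - move=> v s vn ss vt'; case: tri => [[nv1 _ _ _ nc]|/(_ v vn)[_ h _]].
      move: (nc s); rewrite tE ?nv1 // -(dtvE HD) //.
      by move: vn vt'; rewrite nv1; case: v => // _ ->.
    by apply: h => //; rewrite !tE // -!(dtvE HD).
case=> [|k] kM; last first.
  have [v [s [_ [inc _ _ _]]]] := ext k kM.
  by have [a b c] := top _ kM; split; [apply: inG | case: inc].
split=> //; case: G0 => n0 t0 e0; have [nN tD _] := top _ kM.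
have te0 : te (Gs 0%N) = [::] by case: (te _) e0 => // x l /(_ x); rewrite mem_head.
have src0 : vt sigma (vert 0) = Src.
  by have := D_root HD; rewrite -vert0 (dtvE HD) // => /eqP.
split; rewrite ?n0 ?te0 //=; first exact: ltnW.
- by move=> u t; rewrite ltnS leqn0 => /eqP->; rewrite t0 ?n0 //= src0; case: t.
- by move=> v; rewrite ltnS leqn0 => ->.
- move=> v s; rewrite ltnS leqn0 => /eqP-> _; rewrite (dtvE HD) //.
  by rewrite src0.
Qed.

Lemma stage_loose st G : stage G -> st.1 = vrecs (nv G) -> perm_eq st.2 (te G) ->
  forall v s, loose_end sigma (graph unit st) v s = loose_end sigma G v s.
Proof.
move=> [_ tE _ _ _] stE pe v s; apply: loose_end_congr => //=; first by rewrite stE size_map size_iota.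
move=> u t; rewrite stE size_map size_iota => un.
by rewrite tE // /vty (vertex_vrecs stE).
Qed.

Lemma stage_urgent st G v s : stage G -> st.1 = vrecs (nv G) -> perm_eq st.2 (te G) ->
  most_urgent sigma G v s -> urgent unit sigma st = (v, s).
Proof.
move=> sG stE pe [lo mu]; apply: most_urgent_urgent; first exact: ltnW.
by split=> [|v' s']; rewrite (stage_loose sG stE pe) //; apply: mu.
Qed.

Lemma stage_live st G v s : (1 < dN D)%N -> stage G -> st.1 = vrecs (nv G) -> perm_eq st.2 (te G) ->
  most_urgent sigma G v s -> live unit sigma st.
Proof.
move=> n1 sG stE pe [lo _]; apply/orP; right; apply/andP; split; last first.
  by apply/has_loose; [exact: ltnW | exists v, s; rewrite (stage_loose sG stE pe)].
case: sG => /andP[n0 _] _ _ _ _.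
rewrite /vkap (vertex_vrecs stE) //= vert0 (D_kap0 sigma_ge2 HD).
by apply/negP; apply: (src_not_snk HD n1); apply: D_root HD.
Qed.

End Labelling.


(** * The word of a contour and the lower bound on its weight *)

Section Word.
Context {R : realFieldType} {L : countType} (mul : L -> L -> L) (unit : L) (inv : L -> L).
Hypothesis mulA : forall x y z, mul x (mul y z) = mul (mul x y) z.
Hypothesis mul1x : forall x, mul unit x = x.
Hypothesis mulx1 : forall x, mul x unit = x.
Hypothesis mulxV : forall x, mul x (inv x) = unit.
Context (h : L -> int) (hM : forall x y, h (mul x y) = h x + h y).
Context (sigma m : nat) (A : nat -> nat -> seq L).
Hypothesis sigma_ge2 : (2 <= sigma)%N.
Hypothesis A_h : forall s k, (1 <= s <= sigma)%N -> (1 <= k <= m)%N ->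
           all (fun i => h i == 1) (A s k).
Variables (abul acir : nat -> nat -> L -> R) (rhat : vtype -> nat -> R) (phat pcir : R).
Hypothesis abul_ge0 : forall s k j, (1 <= s <= sigma)%N -> (1 <= k <= m)%N -> 0 <= abul s k j.
Hypothesis acir_ge0 : forall s k j, (1 <= s <= sigma)%N -> (1 <= k <= m)%N -> 0 <= acir s k j.
Hypothesis rhat_ge0 : forall t k, (t = Src \/ exists2 s, (1 <= s <= sigma)%N & t = Chg s) ->
                0 <= rhat t k.
Hypothesis phat0 : 0 <= phat.
Hypothesis phat1 : phat <= 1.
Hypothesis pcir0 : 0 <= pcir.
Hypothesis pcir1 : pcir <= 1.
Hypothesis Bbul_pos : 0 < Bbul sigma m A abul.
Hypothesis Bcir_pos : 0 < Bcir sigma m A acir.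

Local Notation kernelD := (kernel mul inv unit sigma m A abul acir rhat phat pcir).
Local Notation stepD := (step mul inv unit sigma).
Hypothesis kernel_ge0 : forall st x, 0 <= kernelD st x.

Variables (D : dcontour L) (eta : 'I_(dN D) -> 'I_(dN D)).
Hypothesis HD : in_D0 mul inv unit sigma m A D.
Hypothesis eta_inj : injective eta.
Hypothesis eta_root : nat_of_ord (eta (droot D)) = 0%N.

Local Notation lab := (lab eta).
Local Notation vert := (vert eta_inj).
Local Notation vrec := (vrec sigma eta_inj).
Local Notation vrecs := (vrecs sigma eta_inj).
Local Notation stage := (stage sigma eta_inj).
Local Notation edgeD := (edge_wt mul inv sigma m A abul acir pcir (D:=D)).
Let psi := dpsi D.
Let kap := dkappa D.

Definition site_wt (v : 'I_(dN D)) : R := vertex_wt m rhat phat (tau' sigma D v) (kap (psi v)).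
Definition sites_wt n : R := \prod_(i <- iota 0 n | first eta (vert i)) site_wt (vert i).
Definition unlab (e : nat * nat * nat) : 'I_(dN D) * 'I_(dN D) * nat :=
  (vert e.1.1, vert e.1.2, e.2).

Lemma site_wt_ge0 v : 0 <= site_wt v.
Proof.
rewrite /site_wt /vertex_wt (D_kap0 sigma_ge2 HD); case: ifP => // nS.
rewrite (D_kap_le HD) mulr_ge0 ?subr_ge0 //; apply: rhat_ge0; rewrite /tau'.
case: ifP => _; first by right; exists 1%N; rewrite //= ltnW.
have := dtv_vt HD v; rewrite /vt; case: ifP => _; first by left.
by rewrite nS => b; right; move: (D_chg_range HD b); exists (nth 0%N [seq s <- iota 1 sigma | dtv D v (Chg s)] 0%N).
Qed.

Lemma sites_wt_ge0 n : 0 <= sites_wt n.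
Proof. by apply: prodr_ge0 => i _; apply: site_wt_ge0. Qed.

Lemma edge_kap v w s : (v, w, s) \in dte D -> (1 <= kap (psi v) <= m)%N.
Proof.
move=> eD; rewrite (D_kap_le HD) andbT lt0n (D_kap0 sigma_ge2 HD).
apply/negP => vS; have [o _] := D_snk HD vS.
by have := dout_gt0 eD; rewrite o.
Qed.

Lemma jump_wt_ge0 e : e \in dte D -> 0 <= jump_wt mul inv abul acir e.
Proof.
case: e => [[v w] s] eD; have k1 := edge_kap eD; have hs := D_range HD eD.
by rewrite /jump_wt /=; case: ifP => _; [apply: acir_ge0 | apply: abul_ge0].
Qed.

Lemma edge_wt_ge0 e : e \in dte D -> 0 <= edgeD e.
Proof.
move=> /jump_wt_ge0 j0; rewrite /edge_wt mulr_ge0 //; case: ifP => // _.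
by case: ifP => _; rewrite divr_ge0 ?subr_ge0 // ltW.
Qed.

(** The root is set aside by 0 < n: there [tau'] is [Chg 1] while [vt] is [Src]; at all other
    vertices they agree. *)
Lemma sites_wtS n st : (0 < n < dN D)%N -> st.1 = vrecs n ->
  sites_wt n.+1 = sites_wt n *
    (if psi (vert n) \in positions st then 1 else
      vertex_wt m rhat phat (vt sigma (vert n)) (kap (psi (vert n)))).
Proof.
move=> /andP[n0 nN] stE; rewrite /sites_wt -addn1 iotaD big_cat /= add0n; congr (_ * _).
rewrite big_cons big_nil mulr1 (first_positions nN stE); case: (_ \in _) => //=.
by rewrite /site_wt /tau' (vert_root eta_inj eta_root nN) gtn_eqF.
Qed.

Lemma edge_wt_lt st v w s : (s <= sigma)%N -> vertex unit st v = vrec v -> (v < dN D)%N ->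
  (vert v, vert w, s) \in dte D -> (s < sigma)%N ->
  edgeD (vert v, vert w, s) =
    star_wt sigma pcir s false *
    pos_wt unit sigma m A abul acir st (v, s) false (edge_jump mul inv (vert v, vert w, s)).
Proof.
move=> hs vE vN eD ss; have k1 := edge_kap eD.
rewrite /edge_wt /star_wt /pos_wt /= ss mul1r ltn_eqF // mulr1 /vkap /vty vE /= -/psi -/kap k1.
rewrite /jump_wt /cir /= (vert_root eta_inj eta_root vN).
have -> : (vt sigma (vert v) == Src) = dtv D (vert v) Src.
  rewrite /vt; case: (dtv D _ Src) => //; by case: ifP.
by case: ifP.
Qed.

(** Here weight may be lost: the law at the actual decoration of the starting point is bounded by
    the maximum over all decorations. *)
Lemma edge_wt_sigma st v w : (vert w, vert v, sigma) \in dte D ->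
  let e := (vert w, vert v, sigma) in
  edgeD e <= star_wt sigma pcir sigma (cir e) *
    pos_wt unit sigma m A abul acir st (v, sigma) (cir e) (edge_jump mul inv e).
Proof.
move=> eD /=; have k1 := edge_kap eD; set e := (_, _, _) in eD *.
rewrite /edge_wt /star_wt /pos_wt /= ltnn eqxx /jump_wt.
case: (cir e); rewrite [X in _ <= X]mulrCA;
  (apply: ler_wpM2r; [by rewrite divr_ge0 ?subr_ge0 // ltW | exact: (maxw_ge _ _ _ k1)]).
Qed.

Lemma back_jump x y : mul y (inv (mul (inv x) y)) = x.
Proof.
have xz z : mul x (mul (inv x) z) = z by rewrite mulA mulxV mul1x.
by rewrite -{1}(xz y) -mulA mulxV mulx1.
Qed.

Lemma forw_jump x y : mul x (mul (inv x) y) = y.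
Proof. by rewrite mulA mulxV mul1x. Qed.

(** One extension is one transition. The symbol is read off the added edge; the main point is that
    the rule in [step] recognises correctly whether [w] is already explored. *)
Lemma step_lower (st : @state L) G H v s : (1 < dN D)%N -> stage G -> stage H -> tconnected H ->
  st.1 = vrecs (nv G) -> perm_eq st.2 (te G) ->
  most_urgent sigma G v s -> extension sigma G H v s ->
  exists x e, [/\ (stepD st x).1 = vrecs (nv H), (stepD st x).2 = e :: st.2,
     perm_eq (e :: st.2) (te H), unlab e \in dte D &
     sites_wt (nv H) * edgeD (unlab e) <= sites_wt (nv G) * kernelD st x].
Proof.
move=> n1 sG sH cH st1 st2 mu [_ nGH _ [w [eG teH]]].
have uE := stage_urgent unit sigma_ge2 sG st1 st2 mu.
have [lo _] := mu; have vn : (v < nv G)%N by case/andP: lo.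
case: (sG) => /andP[n0 nN] _ [uG epG] S1 S2.
case: (sH) => /andP[_ nHN] _ [uH epH] _ _.
have szst : size st.1 = nv G by rewrite st1 size_map size_iota.
have szst0 : (size st.1 == 0%N) = false by rewrite szst gtn_eqF.
have stv u : (u < nv G)%N -> vertex unit st u = vrec u by exact: vertex_vrecs.
set e := if _ then _ else _ in eG teH.
have eeH : e \in te H by rewrite teH mem_head.
have [e1H e2H eD] := epH _ eeH.
have peH : perm_eq (e :: st.2) (te H).
  apply: uniq_perm => //=; first by rewrite (perm_uniq st2) uG (perm_mem st2) eG.
  by move=> e'; rewrite teH !inE (perm_mem st2).
have wn : (w < nv H)%N by move: e1H e2H; rewrite /e; case: ifP.
have ep' e' : e' \in te G -> (e'.1.1 < nv G /\ e'.1.2 < nv G)%N by case/epG.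
have nw := extension_new_vertex cH ep' n0 vn nGH wn teH.
set p := psi (vert w).
have kapp : p \in positions st -> vkap unit st (index p (positions st)) = kap p.
  by move=> pp; have [lt ep] := index_positions unit st1 pp; rewrite /vkap stv //= ep.
have vN : (v < dN D)%N := leq_trans vn nN.
have wN : (w < dN D)%N := leq_trans wn nHN.
have unlabe : unlab e \in dte D := eD.
(* On a visited site the symbol carries the dummy 0, which has weight 1. *)
set k := if p \in positions st then 0%N else kap p.
have kE : (if p \in positions st then vkap unit st (index p (positions st)) else k) = kap p.
  by rewrite /k; case: (p \in positions st) kapp => // kapp; exact: kapp.
(* Reduces the new state, for both kinds of charge, to the correctness of the test [old]. *)
have shape (old : bool) t :
    (old -> [/\ nv H = nv G, p \in positions st & index p (positions st) = w]) ->
    (~~ old -> [/\ nv H = (nv G).+1, w = nv G & t = vt sigma (vert w)]) ->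
    (if old then st.1 else rcons st.1 (t, p, kap p)) = vrecs (nv H) /\
    (if old then index p (positions st) else size st.1) = w.
  case: old => [/(_ isT)[-> _ ->] _|_ /(_ isT)[-> wE tE]] //; split; last by rewrite szst.
  by rewrite st1 /vrecs -addn1 iotaD map_cat cats1 /= add0n /vrec tE -wE.
have sites t : (w = nv G -> vertex_wt m rhat phat t (kap p) =
      vertex_wt m rhat phat (vt sigma (vert w)) (kap p)) ->
    sites_wt (nv H) = sites_wt (nv G) *
      (if p \in positions st then 1 else vertex_wt m rhat phat t (kap p)).
  case: nw => -[-> wE] tE.
    have -> : p \in positions st by apply/(mem_positions _ st1); exists w.
    by rewrite mulr1.
  have nGN : (0 < nv G < dN D)%N by rewrite n0 -wE.
  by rewrite (sites_wtS nGN st1) (tE wE) -wE.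
have [ss|ss] := ltnP s sigma.
  have eE : e = (v, w, s) by rewrite /e ss.
  rewrite eE /= in eD eeH.
  pose x : symbol := (false, edge_jump mul inv (vert v, vert w, s), k).
  have posE : newpos mul inv unit sigma st (v, s) x.1.2 = p.
    by rewrite /newpos /= ss /vpos stv //= /edge_jump /= forw_jump.
  have kerE : kernelD st x = edgeD (unlab e) *
      (if p \in positions st then 1 else vertex_wt m rhat phat (Chg s) (kap p)).
    rewrite /kernel szst0 uE posE /= eE (edge_wt_lt (st := st)) ?stv ?(ltnW ss) //; congr (_ * _).
    by rewrite /kap_wt /newtype ss /k; case: (p \in positions st).
  have tgt := D_edge_tgt HD eD.
  have vtw : (if kap p == 0%N then Snk else Chg s) = vt sigma (vert w).
    apply/eqP; rewrite -(dtvE HD) // (D_kap0 sigma_ge2 HD).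
    by case: ifP tgt => // ->.
  have [] := shape ((p \in positions st) && (kap p == 0%N)) (if kap p == 0%N then Snk else Chg s).
  (* Decoration 0 means that [w] is a sink, and a sink shares its site with no other vertex. *)
  - move=> /andP[pp k0]; rewrite (D_kap0 sigma_ge2 HD) in k0.
    have [lt ep] := index_positions unit st1 pp.
    have iw : index p (positions st) = w.
      by apply: (vert_inj (eta_inj := eta_inj)); rewrite ?(leq_trans lt) // (D_snk_sep HD k0 (esym ep)).
    by case: nw => -[nHE wE]; split=> //; move: lt; rewrite iw wE ltnn.
  (* An explored [w] that is not a sink would already have an incoming edge of charge [s]; by
     uniqueness it is the added edge, which is absent from [G]. *)
  - move=> nold; case: nw => -[nHE wE]; last by split; rewrite ?vtw.
    have pp : p \in positions st by apply/(mem_positions _ st1); exists w.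
    rewrite pp /= (D_kap0 sigma_ge2 HD) in nold; rewrite (negPf nold) /= in tgt.
    have := S2 _ _ wE ss tgt; rewrite -has_count => /hasP[[[v' w'] s'] eG' /= /andP[/eqP ww' /eqP ss']].
    have [e1' _ /= eD'] := epG _ eG'; rewrite /= ww' ss' in e1' eG' eD'.
    have /(vert_inj) vv' := D_in_uniq HD eD eD'.
    by rewrite eE vv' ?eG' ?(leq_trans e1') in eG.
  - move=> V1 W1; exists x, e; split=> //; rewrite ?kerE.
    + by rewrite /step szst0 uE posE /= ss kE -V1 /newtype ss.
    + by rewrite /step szst0 uE posE /= ss kE W1 eE.
    (* For a sink the types [Chg s] and [Snk] give the same weight, because [vertex_wt] ignores the
       type at decoration 0. *)
    + rewrite (sites (Chg s)); first by rewrite mulrAC mulrA.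
      by move=> _; rewrite -vtw /vertex_wt; case: ifP.
have {ss}sE : s = sigma.
  by case/andP: lo => _ /orP[/and4P[_]|/and3P[/eqP]] //; rewrite ltnNge ss.
have eE : e = (w, v, sigma) by rewrite /e sE ltnn.
rewrite {}sE in mu uE lo *.
rewrite eE /= in eD eeH.
set b := cir (unlab e); set ed := (vert w, vert v, sigma) in eD.
pose x : symbol := (b, edge_jump mul inv ed, k).
have edE : unlab e = ed by rewrite eE.
have posE : newpos mul inv unit sigma st (v, sigma) x.1.2 = p.
  by rewrite /newpos /= ltnn /vpos stv //= /edge_jump /= back_jump.
have kerE : edgeD (unlab e) *
      (if p \in positions st then 1 else vertex_wt m rhat phat (newtype sigma sigma b) (kap p))
      <= kernelD st x.
  rewrite /kernel szst0 uE posE /= edE /kap_wt /k.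
  have le := edge_wt_sigma st eD; rewrite /b edE.
  case: (p \in positions st) => /=.
    by rewrite (_ : (0 == 0)%N%:R = 1) ?mulr1.
  apply: ler_wpM2r le; rewrite /vertex_wt; case: ifP => // _; case: ifP => // _.
  apply: mulr_ge0; rewrite ?subr_ge0 //; apply: rhat_ge0; apply: newtype_valid => //.
  by rewrite leqnn ltnW.
have src := D_edge_src HD eD.
have bE : b = dtv D (vert w) Src && (w != 0%N).
  by rewrite /b edE /cir /= (vert_root eta_inj eta_root wN).
(* An explored starting point other than the root already has its outgoing edge of charge [sigma],
   which would be the added one. *)
have w0 : (w < nv G)%N -> w = 0%N.
  move=> wG; apply/eqP; apply: contraT => w0.
  have := S1 _ wG w0 src; rewrite -has_count => /hasP[[[w' v'] s'] eG' /= /andP[/eqP ww' /eqP ss']].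
  have [_ e1' /= eD'] := epG _ eG'; rewrite /= ww' ss' in e1' eG' eD'.
  have /(vert_inj) vv' := D_out_uniq HD eD eD'.
  by rewrite eE vv' ?eG' ?(leq_trans e1') in eG.
have vtw : w != 0%N -> newtype sigma sigma b = vt sigma (vert w).
  move=> wn0; apply/eqP; rewrite -(dtvE HD) // bE wn0 andbT /newtype ltnn.
  by case: ifP src => // ->.
have [] := shape ((p \in positions st) && (~~ b && (p == unit))) (newtype sigma sigma b).
- move=> /and3P[pp nb /eqP pu].
  (* An unstarred starting point is the root or lies in V_sigma, and [psi] is injective on these
     vertices together. *)
  have wr : w = 0%N.
    apply/eqP; apply: contraT => wn0; rewrite bE wn0 andbT in nb; rewrite (negPf nb) /= in src.
    move: wn0; rewrite -(vert_root eta_inj eta_root wN) => /eqP[].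
    apply: (D_inj HD (s := sigma)); rewrite ?leqnn ?(ltnW sigma_ge2) ?src ?eqxx ?orbT //.
    by rewrite (D_unit HD).
  case: nw => -[nHE wE]; last by rewrite -wE wr in n0.
  split=> //; rewrite (positions_vrecs st1) wr; case: (nv G) n0 => //= n _.
  by rewrite (vert0 eta_inj eta_root) (D_unit HD) pu eqxx.
- move=> nold; case: nw => -[nHE wE].
    have wr := w0 wE; case/negP: nold.
    have -> : p \in positions st by apply/(mem_positions _ st1); exists w.
    by rewrite bE wr eqxx andbF /= /p /psi wr (vert0 eta_inj eta_root) (D_unit HD) eqxx.
  by split; rewrite ?vtw // wE -lt0n.
- move=> V1 W1; exists x, e; split=> //.
  + by rewrite /step szst0 uE posE /= ltnn kE -V1.
  + by rewrite /step szst0 uE posE /= ltnn W1 eE.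
  + rewrite (sites (newtype sigma sigma b)); last by move=> wE; rewrite vtw // wE -lt0n.
    by rewrite -mulrA ler_wpM2l ?sites_wt_ge0 // mulrC.
Qed.

Local Notation start := (([::], [::]) : @state L).
Local Notation run := (foldl stepD start).

Lemma root_vrec : vrec 0 = (Src, unit, kap unit).
Proof. by rewrite /vrec (vert0 eta_inj eta_root) /vt (D_root HD) (D_unit HD). Qed.

Definition root_symbol : @symbol L := (false, unit, kap unit).

Lemma run_root : run [:: root_symbol] = (vrecs 1, [::]).
Proof. by rewrite /vrecs /= root_vrec. Qed.

Lemma root_lower : sites_wt 1 <= weight stepD kernelD start [:: root_symbol].
Proof.
rewrite /= mulr1 /kernel /= eqxx mul1r /sites_wt big_cons big_nil mulr1.
rewrite (vert0 eta_inj eta_root) ifT; last first.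
  by apply/forallP => w; rewrite eta_root leq0n implybT.
by rewrite /site_wt /tau' eqxx /psi (D_unit HD).
Qed.

(** One letter for the root and one per extension. All proper prefixes lead to live states because
    each stage that is extended has a loose end; this is what makes the words prefix-free. *)
Lemma words_of_stages M Gs : (1 < dN D)%N ->
  tg_eq (Gs 0%N) triv_incomplete -> tg_eq (Gs M) (relabel D lab) ->
  (forall k, (k < M)%N -> exists v s,
     most_urgent sigma (Gs k) v s /\ extension sigma (Gs k) (Gs k.+1) v s) ->
  forall k, (k <= M)%N -> exists u,
  [/\ (run u).1 = vrecs (nv (Gs k)), perm_eq (run u).2 (te (Gs k)),
     (forall e, e \in (run u).2 -> unlab e \in dte D),
     (forall l, (l < size u)%N -> live unit sigma (run (take l u))) &
     sites_wt (nv (Gs k)) * \prod_(e <- (run u).2) edgeD (unlab e) <= weight stepD kernelD start u].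
Proof.
move=> n1 G0 GM ext; have sG := stages HD eta_inj eta_root n1 G0 GM ext.
elim=> [|k IH] kM.
  exists [:: root_symbol]; rewrite run_root; case: G0 => n0 _ e0; split=> //=.
  - by rewrite n0.
  - by case: (te _) e0 => // x l /(_ x); rewrite mem_head.
  - by case.
  - by rewrite n0 big_nil mulr1; apply: root_lower.
have [u [st1 st2 uD lu wu]] := IH (ltnW kM).
have [sk _] := sG k (ltnW kM); have [sk1 /(_ isT) ck1] := sG k.+1 kM.
have [v [s [mu ex]]] := ext k kM.
have [x [e [x1 x2 pe eD le]]] := step_lower n1 sk sk1 ck1 st1 st2 mu ex.
exists (rcons u x); rewrite foldl_rcons; split=> //; rewrite ?x2 //.
- by move=> e'; rewrite inE => /orP[/eqP->|/uD].
- move=> l; rewrite size_rcons ltnS -cats1 => lu'; rewrite takel_cat //.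
  move: lu'; rewrite leq_eqVlt => /orP[/eqP->|]; last exact: lu.
  by rewrite take_size (stage_live sigma_ge2 HD eta_root n1 sk st1 st2 mu).
rewrite weight_rcons big_cons mulrA.
apply: le_trans (ler_wpM2r (kernel_ge0 _ _) wu).
rewrite [X in _ <= X]mulrAC; apply: ler_wpM2r le.
by rewrite big_seq; apply: prodr_ge0 => e' /uD /edge_wt_ge0.
Qed.

Lemma sites_wt_all : sites_wt (dN D) = \prod_(v | first eta v) site_wt v.
Proof.
rewrite /sites_wt -{1}[dN D]subn0 big_mkord (reindex_inj eta_inj) /=.
by apply: eq_big => [v|v _]; rewrite -/(lab v) labK.
Qed.

(** In a complete Toom graph every vertex has all the edges that its type requires. *)
Lemma final_not_live E : (1 < dN D)%N -> perm_eq E (te (relabel D lab)) ->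
  ~~ live unit sigma (vrecs (dN D), E).
Proof.
move=> n1 pE; rewrite /live /= size_map size_iota gtn_eqF ?(ltnW n1) //= negb_and.
have szE : nv (graph unit (vrecs (dN D), E)) = dN D by rewrite /= size_map size_iota.
have lE v s : loose_end sigma (graph unit (vrecs (dN D), E)) v s = loose_end sigma (relabel D lab) v s.
  apply: loose_end_congr => [|u t|]; [exact: szE | rewrite szE => uN | exact: pE].
  rewrite [LHS]/= /vty (@vertex_vrecs _ unit _ _ _ eta_inj (vrecs (dN D), E) (dN D) u erefl uN).
  by rewrite -(dtvE HD) // -{2}(vertK eta_inj uN) (tv_relabel (lab_inj eta_inj)).
apply/orP; right; apply/(has_loose unit _ (ltnW sigma_ge2)) => -[v [s]].
rewrite lE => /andP[]; rewrite [nv _]/= => vN; rewrite -(vertK eta_inj vN); move: (vert v) => {vN}v.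
rewrite !(tv_relabel (lab_inj eta_inj)) (outdeg_relabel (lab_inj eta_inj)) (indeg_relabel (lab_inj eta_inj)).
rewrite -/(dout v s) -/(din v sigma) => /orP[/and4P[s1 ss vt /eqP d0]|/and3P[_ vt /eqP d0]].
  case/orP: vt => [vS|/(D_chg HD)[_]]; last by rewrite d0.
  have nS : ~~ dtv D v Snk by apply/negP; apply: src_not_snk HD _ n1 vS.
  by have := dout_src HD nS vS (s := s); rewrite d0 s1 ltnW // => /(_ isT).
case/orP: vt => [vS|/(D_chg HD)[]]; last by rewrite d0.
(* The in-degrees of a sink agree for all charges, so a missing charge-[sigma] edge would leave it
   isolated. *)
have [o0 [d [_ dd]]] := D_snk HD vS; case: (HD) => _ cG _ _ _.
have [e /mapP[[[a b] c] eD ->] /= [/ord_inj av|/ord_inj bv]] := connected_incident cG n1 (ltn_ord v).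
  by have := dout_gt0 eD; rewrite av o0.
have := din_gt0 eD; rewrite bv dd ?(D_range HD eD) //.
by rewrite -(dd sigma) ?d0 // leqnn ltnW.
Qed.

Lemma word_of_contour :
  dN D = 1%N \/ obtained_by_extensions sigma (relabel D lab) ->
  exists w E, [/\ run w = (vrecs (dN D), E), perm_eq E (te (relabel D lab)),
    (forall k, (k < size w)%N -> live unit sigma (run (take k w))),
    ~~ live unit sigma (vrecs (dN D), E) &
    nu mul inv sigma m A abul acir rhat phat pcir D eta <= weight stepD kernelD start w].
Proof.
rewrite (nuE mulA mul1x mulxV hM sigma_ge2 A_h _ _ _ _ _ HD eta_inj).
rewrite -/(site_wt _) -sites_wt_all.
have [n1|n1 nat_ext] := leqP (dN D) 1.
  have {}n1 : dN D = 1%N by apply/eqP; rewrite eqn_leq n1 (leq_ltn_trans _ (ltn_ord (droot D))).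
  (* The trivial contour is the one-letter word that decorates the root by 0, after which the
     exploration stops. *)
  move=> _; exists [:: root_symbol], [::]; rewrite run_root {1}n1 /= (D_trivial HD n1); split=> //.
  - by case.
  - rewrite /live n1 /= /vkap /= (vert0 eta_inj eta_root) (D_kap0 sigma_ge2 HD).
    by rewrite (dtv1 HD).
  - by rewrite big_nil mulr1 n1; apply: root_lower.
case: nat_ext => [n1'|[M [Gs [G0 GM ext]]]]; first by rewrite n1' in n1.
have [u [st1 st2 uD lu wu]] := words_of_stages n1 G0 GM ext (leqnn M).
have [nM _ eM] := GM; have [[_ _ [uM _] _ _] _] := stages HD eta_inj eta_root n1 G0 GM ext (leqnn M).
rewrite nM /= in st1 wu.
have pE : perm_eq (run u).2 (te (relabel D lab)).
  apply: perm_trans st2 (uniq_perm uM _ eM).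
  by rewrite map_inj_uniq ?(D_uniq HD) //; apply: relabel_edge_inj; apply: lab_inj.
exists u, (run u).2; split=> //; first by rewrite -st1; case: (run u).
  exact: final_not_live.
apply: le_trans wu; rewrite (perm_big _ pE) big_map le_eqVlt; apply/orP; left.
apply/eqP; congr (_ * _); apply: eq_bigr => -[[a b] c] _.
by rewrite /unlab /= !labK.
Qed.

End Word.

(** * Recovering a contour from its word, and the bound on the sum *)

Lemma iso_of_states (L : countType) (mul : L -> L -> L) (inv : L -> L) (unit : L)
  (sigma m : nat) (A : nat -> nat -> seq L) (D D' : dcontour L)
  (eta : 'I_(dN D) -> 'I_(dN D)) (eta' : 'I_(dN D') -> 'I_(dN D'))
  (eta_inj : injective eta) (eta'_inj : injective eta') E :
  in_D0 mul inv unit sigma m A D -> in_D0 mul inv unit sigma m A D' ->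
  nat_of_ord (eta (droot D)) = 0%N -> nat_of_ord (eta' (droot D')) = 0%N ->
  vrecs sigma eta_inj (dN D) = vrecs sigma eta'_inj (dN D') ->
  perm_eq E (te (relabel D (lab eta))) -> perm_eq E (te (relabel D' (lab eta'))) ->
  dc_iso D D'.
Proof.
move=> HD HD' r r' eqV pE pE'.
have eN : dN D = dN D' by have := congr1 size eqV; rewrite !size_map !size_iota.
have ltD v : (lab eta v < dN D)%N by exact: ltn_ord.
have ltD' v : (lab eta' v < dN D')%N by exact: ltn_ord.
(* Vertices of equal rank are matched. *)
pose chi v := vert eta'_inj (lab eta v).
have chiK v : lab eta' (chi v) = lab eta v by rewrite vertK -?eN.
have rec v : vrec sigma eta_inj (lab eta v) = vrec sigma eta'_inj (lab eta v).
  have := congr1 (nth (vrec sigma eta_inj 0) ^~ (lab eta v)) eqV.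
  by rewrite !(nth_map 0%N) ?size_iota -?eN // !nth_iota -?eN.
have recE v : [/\ vt sigma v = vt sigma (chi v), dpsi D v = dpsi D' (chi v) &
    dkappa D (dpsi D v) = dkappa D' (dpsi D' (chi v))].
  by have := rec v; rewrite /vrec labK => -[].
exists chi; split.
- split.
    exists (fun v => vert eta_inj (lab eta' v)) => v; first by rewrite chiK labK.
    by rewrite /chi vertK ?labK // eN.
  by apply: (lab_inj eta'_inj); rewrite chiK /lab r r'.
- move=> v t; have [vE _ _] := recE v.
  (* In the trivial contour [vt] shows only one of the two types of the vertex, so this case is
     separate. *)
  have [n1|n1] := leqP (dN D) 1.
    have {}n1 : dN D = 1%N by apply/eqP; rewrite eqn_leq n1 (leq_ltn_trans _ (ltD v)).
    by rewrite (dtv1 HD) // (dtv1 HD') // -eN.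
  by rewrite (dtvE HD) // (dtvE HD') -?eN // vE.
- move=> v w s; rewrite -(mem_relabel (lab_inj eta_inj)) -(mem_relabel (lab_inj eta'_inj)) !chiK.
  by rewrite -(perm_mem pE) (perm_mem pE').
- by move=> v; have [] := recE v.
- by move=> v; have [_ -> ->] := recE v.
Qed.


Theorem mainTheorem11
  (R : realFieldType)
  (* the countable group Lambda, with product mul, unit e ("0") and inverse inv *)
  (L : countType) (mul : L -> L -> L) (e : L) (inv : L -> L)
  (mulA : forall x y z, mul x (mul y z) = mul (mul x y) z)
  (mul1x : forall x, mul e x = x) (mulx1 : forall x, mul x e = x)
  (mulVx : forall x, mul (inv x) x = e) (mulxV : forall x, mul x (inv x) = e)
  (* homomorphism h : Lambda -> Z *)
  (h : L -> int) (hM : forall x y, h (mul x y) = h x + h y)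
  (sigma m : nat) (sigma_ge2 : (2 <= sigma)%N) (m_ge1 : (1 <= m)%N)
  (A : nat -> nat -> seq L)
  (A_ne : forall s k, (1 <= s <= sigma)%N -> (1 <= k <= m)%N -> A s k != [::])
  (A_h : forall s k, (1 <= s <= sigma)%N -> (1 <= k <= m)%N ->
           all (fun i => h i == 1) (A s k))
  (abul acir : nat -> nat -> L -> R)
  (abul_ge0 : forall s k j, (1 <= s <= sigma)%N -> (1 <= k <= m)%N -> 0 <= abul s k j)
  (abul_supp : forall s k j, (1 <= s <= sigma)%N -> (1 <= k <= m)%N ->
                 j \notin A s k -> abul s k j = 0)
  (abul_sub : forall s k, (1 <= s <= sigma)%N -> (1 <= k <= m)%N ->
                 \sum_(j <- undup (A s k)) abul s k j <= 1)
  (acir_ge0 : forall s k j, (1 <= s <= sigma)%N -> (1 <= k <= m)%N -> 0 <= acir s k j)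
  (acir_supp : forall s k j, (1 <= s <= sigma)%N -> (1 <= k <= m)%N ->
                 j \notin Delta_list sigma A k -> acir s k j = 0)
  (acir_sub : forall s k, (1 <= s <= sigma)%N -> (1 <= k <= m)%N ->
                 \sum_(j <- undup (Delta_list sigma A k)) acir s k j <= 1)
  (* rhat_t for t in {o,1,...,sigma}: probability distributions on {1,...,m} *)
  (rhat : vtype -> nat -> R)
  (rhat_ge0 : forall t k, (t = Src \/ exists2 s, (1 <= s <= sigma)%N & t = Chg s) ->
                0 <= rhat t k)
  (rhat_supp : forall t k, (t = Src \/ exists2 s, (1 <= s <= sigma)%N & t = Chg s) ->
                ~~ (1 <= k <= m)%N -> rhat t k = 0)
  (rhat_sum : forall t, (t = Src \/ exists2 s, (1 <= s <= sigma)%N & t = Chg s) ->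
                \sum_(1 <= k < m.+1) rhat t k = 1)
  (phat pcir : R) (phat0 : 0 <= phat) (phat1 : phat <= 1)
  (pcir0 : 0 <= pcir) (pcir1 : pcir <= 1)
  (Bbul_pos : 0 < Bbul sigma m A abul) (Bcir_pos : 0 < Bcir sigma m A acir)
  (* any finite family of pairwise non-isomorphic elements of D_0, each with its
     natural labelling (natural order) *)
  (n : nat) (Ds : 'I_n -> dcontour L)
  (etas : forall k : 'I_n, 'I_(dN (Ds k)) -> 'I_(dN (Ds k)))
  (Ds_D0 : forall k, in_D0 mul inv e sigma m A (Ds k))
  (etas_nat : forall k, natural_labelling sigma (Ds k) (etas k))
  (Ds_distinct : forall k l, k != l -> ~ dc_iso (Ds k) (Ds l)) :
  \sum_(k < n) nu mul inv sigma m A abul acir rhat phat pcir (Ds k) (etas k) <= 1.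
Proof.
pose K := kernel mul inv e sigma m A abul acir rhat phat pcir.
pose stp := step mul inv e sigma.
pose start : @state L := ([::], [::]).
have Ksub st : subdist (K st) by exact: subdist_kernel.
have K0 st x : 0 <= K st x by case: (Ksub st).
have eta_inj k : injective (etas k) by case: (etas_nat k).
have eta_root k : nat_of_ord (etas k (droot (Ds k))) = 0%N by case: (etas_nat k).
have wordP k : exists w, exists E, [/\ foldl stp start w = (vrecs sigma (eta_inj k) (dN (Ds k)), E),
    perm_eq E (te (relabel (Ds k) (lab (etas k)))),
    (forall l, (l < size w)%N -> live e sigma (foldl stp start (take l w))),
    ~~ live e sigma (vrecs sigma (eta_inj k) (dN (Ds k)), E) &
    nu mul inv sigma m A abul acir rhat phat pcir (Ds k) (etas k) <= weight stp K start w].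
  by case: (etas_nat k) => _ _ Hk; apply: (word_of_contour mulA mul1x mulx1 mulxV hM).
have [w wP] := fin_all_exists wordP.
(* The word of [k] ends in a state that is not live, whereas proper prefixes of the word of [l] lead
   to live states. Hence the words coincide, so do the final states, and the contours are
   isomorphic. *)
have prefix_eq k l : prefix (w k) (w l) -> k = l.
  move=> pkl; have [E [runE pE _ nlE _]] := wP k; have [E' [runE' pE' lE' nlE' _]] := wP l.
  have wkl : w k = w l.
    have wk : w k = take (size (w k)) (w l) by move: pkl; rewrite prefixE => /eqP ->.
    have [lt|ge] := ltnP (size (w k)) (size (w l)).
      by have := lE' _ lt; rewrite -wk runE (negPf nlE).
    by rewrite wk take_oversize.
  apply/eqP; apply: contraT => kl; case: (Ds_distinct k l kl).
  move: runE'; rewrite -wkl runE => -[eV eE]; rewrite -eE in pE'.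
  exact: (iso_of_states (Ds_D0 k) (Ds_D0 l) _ _ eV pE pE').
apply: (@le_trans _ _ (\sum_(k < n) weight stp K start (w k))).
  by apply: ler_sum => k _; have [E []] := wP k.
rewrite -(big_map w xpredT (weight stp K start)); apply: kraft => //.
  rewrite map_inj_uniq ?index_enum_uniq // => k l wkl.
  by apply: prefix_eq; rewrite wkl prefix_refl.
by move=> u v /mapP[k _ ->] /mapP[l _ ->] /prefix_eq->.
Qed.
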